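(* There is a constant $c>0$ such that the following holds. Let $(\varepsilon_n)_{n\ge 1}$ be a real sequence with $\varepsilon_n\to 0$ as $n\to\infty$ and $|\varepsilon_n|<1/9$ for all $n$. Then there is an $n_0$ such that for all $n\ge n_0$ for which $M:=(1+\varepsilon_n)n/2\in\mathbb{N}$, and for all real $A\ge 1$, writing $\varepsilon=\varepsilon_n$: (i) if $\varepsilon<-e\,n^{-1/2}$, then $\mathbb{P}\big(T_{n,M}\le c|\varepsilon|^{-1}\ln(\varepsilon^2 n)/A\big)\le e^{-A}$; (ii) if $|\varepsilon|\le e\,n^{-1/2}$, then $\mathbb{P}\big(T_{n,M}\le c\,n^{1/2}/A\big)\le e^{-A}$; (iii) if $\varepsilon>e\,n^{-1/2}$, then with $k_0:=e^{c\varepsilon^2 n}$, $$\mathbb{P}\big(T_{n,M}<\varepsilon^{-1}k_0/A\big)\le\begin{cases}\exp\left(-\dfrac{A\varepsilon^2 n}{k_0}\right) & \text{if } A>k_0,\\[2mm] A^{-1} & \text{if } A\le k_0.\end{cases}$$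
   Context: Here $e$ is Euler's number, $\mathbb{N}=\{1,2,\dots\}$ and $\mathbb{N}_0=\mathbb{N}\cup\{0\}$. Dispersion process on the complete graph with $n$ vertices and $M\ge 2$ particles: the vertices are $\{1,\dots,n\}$ and the particles are $p_1,\dots,p_M$; $p_{i,t}$ denotes the position of $p_i$ at time $t\in\mathbb{N}_0$. At time $0$ all particles are at vertex $1$ ($p_{i,0}=1$ for all $i$) and all are unhappy: $\mathcal{U}_0=\{p_1,\dots,p_M\}$, $\mathcal{H}_0=\emptyset$. Let $(G_{i,t})_{1\le i\le M,\,t\in\mathbb{N}_0}$ be independent and uniform on $\{1,\dots,n\}$. For $t\in\mathbb{N}_0$ set $p_{i,t+1}=p_{i,t}$ if $p_i\in\mathcal{H}_t$ and $p_{i,t+1}=G_{i,t+1}$ if $p_i\in\mathcal{U}_t$, and set $\mathcal{H}_{t+1}=\{p_i: p_{i,t+1}\ne p_{j,t+1}\text{ for all }j\ne i\}$ (happy particles) and $\mathcal{U}_{t+1}=\{p_1,\dots,p_M\}\setminus\mathcal{H}_{t+1}$ (unhappy particles). Let $U_t=|\mathcal{U}_t|$. The dispersion time is $T_{n,M}=\inf\{t\in\mathbb{N}_0: U_t=0\}$. *)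

(* Defs.v *)
From HB Require Import structures.
From mathcomp Require Import all_boot all_order all_algebra finmap.
From mathcomp Require Import all_classical all_reals all_analysis.
Set Implicit Arguments.
Unset Strict Implicit.
Unset Printing Implicit Defensive.
Import Order.TTheory GRing.Theory Num.Theory.
Import numFieldNormedType.Exports.
Local Open Scope classical_set_scope.
Local Open Scope ring_scope.

(** The dispersion process on the complete graph. The vertices are ['I_n] and the particles are ['I_M]. One realization of
    the process is a function of the start vertex [v0] and of one realization
    [g i t] of the variables G_{i,t}. *)

Definition happy_set (n M : nat) (pos : {ffun 'I_M -> 'I_n}) : {set 'I_M} :=
  [set i | [forall j, (j != i) ==> (pos i != pos j)]].

(** The state at time [t] is the pair (positions, set of happy particles). The
    set of happy particles is part of the state because at time 0 it is empty
    by convention, rather than computed from the positions. *)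
Fixpoint dispersion_state (n M : nat) (v0 : 'I_n) (g : 'I_M -> nat -> 'I_n)
    (t : nat) : {ffun 'I_M -> 'I_n} * {set 'I_M} :=
  if t is t'.+1 then
    let: (pos, H) := dispersion_state v0 g t' in
    let pos' := [ffun i => if i \in H then pos i else g i t] in
    (pos', happy_set pos')
  else ([ffun=> v0], finset.set0).

Definition unhappy_set (n M : nat) (v0 : 'I_n) (g : 'I_M -> nat -> 'I_n)
    (t : nat) : {set 'I_M} :=
  ~: (dispersion_state v0 g t).2.

(** The infimum of the empty set is [+oo]. *)
Definition dispersion_time (R : realType) (n M : nat) (v0 : 'I_n)
    (g : 'I_M -> nat -> 'I_n) : \bar R :=
  ereal_inf [set (t%:R)%:E | t in [set t : nat | #|unhappy_set v0 g t| = 0%N]].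

(** Measurability for the discrete sigma-algebra on ['I_n]. *)
Definition random_vertex (d : measure_display) (Omega : measurableType d)
    (n : nat) (X : Omega -> 'I_n) : Prop :=
  forall B : set 'I_n, measurable (X @^-1` B).

Definition uniform_vertex (d : measure_display) (Omega : measurableType d)
    (R : realType) (P : probability Omega R) (n : nat) (X : Omega -> 'I_n) :
    Prop :=
  forall v : 'I_n, P (X @^-1` [set v]) = (n%:R^-1)%:E.

Definition mutually_independent (d : measure_display)
    (Omega : measurableType d) (R : realType) (P : probability Omega R)
    (I : choiceType) (n : nat) (X : I -> Omega -> 'I_n) : Prop :=
  forall (J : {fset I}) (B : I -> set 'I_n),
    P (\bigcap_(k in [set` J]) (X k @^-1` B k)) =
    (\prod_(k <- J) P (X k @^-1` B k))%E.

Definition iid_uniform (d : measure_display) (Omega : measurableType d)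
    (R : realType) (P : probability Omega R) (n M : nat)
    (G : 'I_M -> nat -> Omega -> 'I_n) : Prop :=
  [/\ forall i t, random_vertex (G i t),
      forall i t, uniform_vertex P (G i t) &
      mutually_independent P (fun k : 'I_M * nat => G k.1 k.2)].

(* Main.v *)
Require Import Defs.
From HB Require Import structures.
From mathcomp Require Import all_boot all_order all_algebra finmap.
From mathcomp Require Import all_classical all_reals all_analysis.
From mathcomp Require Import ring lra zify.
Import Order.TTheory GRing.Theory Num.Theory.
Import numFieldNormedType.Exports.
Local Open Scope classical_set_scope.
Local Open Scope ring_scope.

Set Implicit Arguments.
Unset Strict Implicit.
Unset Printing Implicit Defensive.

(** Let u be the number of unhappy particles. While u is small compared with n,
about half of the vertices carry a happy particle, so an unhappy particle that
jumps either lands on a happy one, which leaves two unhappy particles, or lands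
on an empty vertex, which leaves none. Thus u behaves like a branching process
with offspring 0 or 2, with mean about 1 + eps and variance 1, damped by a term
of order u^2 / n that comes from collisions between unhappy particles. The
theorem says that this process, started at u = M, about n / 2, does not become
extinct early.

The input about one round is a bound on the Laplace transform
([mean_expR_unhappy]): placing the jumping particles one after the other, and
following the number of vertices that carry exactly one particle, gives, for u
small compared with n,

  E exp(- th U') <= exp(- th u (1 + r - 2 u / n) + 0.51 th^2 u),

where U' is the next number of unhappy particles and r is eps for eps < 0 and
eps / 2 otherwise ([exponent_small]).

Fix a sequence of exponents with

  th_(s+1) <= th_s (1 + r) - 0.51 th_s^2 - kap.

If u <= kap n / (2 th_s), the spare term kap pays for the damping 2 u / n, and
E exp(- th_s U') <= exp(- th_(s+1) u). If u is larger, this may fail, but then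
both sides are at most about exp(- kap n / 2), and the inequality holds up to a
small additive error ([mean_expR_le]). Adding up, the probability of extinction
within t rounds is at most exp(- th_t u) plus t errors ([extinct_prob_le]). The
number of rounds does not spoil the sum: an error is a difference of the two
sides, and these differ only by a factor close to 1 where they matter most.

Everything else is a choice of exponents.
- For times of order tau that do not exceed n^(1/2) nor 1 / |eps|, th_s is
  close to the solution of a Riccati equation ([riccati]), and the probability
  of extinction is at most exp(- 1.05 n / tau^2) ([short_time]). This gives part
  (ii), part (i) when A is large, and part (iii) when A > k_0. In the last case
  tau is close to 1 / eps in the worst case and the target is exp(- eps^2 n), so
  it matters that the constant 1.05 is larger than 1.
- For eps < 0 and longer times, th_s = |eps| (1 - 2 |eps|)^s, which stays above
  |eps| (eps^2 n)^(- small constant) up to the time of part (i)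
  ([subcritical_long]).
- For eps > 0 and longer times, the constant sequence th_s = eps / 2 is
  admissible since the drift pays for the quadratic terms, and the error per
  round is of order eps exp(- const eps^2 n) ([supercritical_long]).

The passage from the probability space to iterated averages over uniform
placements uses the independence hypothesis once, for the finitely many jumps
that a bounded number of rounds can use ([prob_dispersed]). *)

(** * One round, one particle at a time *)

Definition lonely (n M : nat) (A : {set 'I_M}) (y : {ffun 'I_M -> 'I_n}) :
  {set 'I_M} :=
  [set i in A | [forall j in A, (j != i) ==> (y i != y j)]].

Notation state n M := ({ffun 'I_M -> 'I_n} * {set 'I_M})%type.

Definition place (n M : nat) (st : state n M) (x : {ffun 'I_M -> 'I_n}) :
    {ffun 'I_M -> 'I_n} :=
  [ffun i => if i \in st.2 then st.1 i else x i].

Definition move_to (n M : nat) (x : {ffun 'I_M -> 'I_n}) (k : 'I_M) (v : 'I_n) :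
    {ffun 'I_M -> 'I_n} :=
  [ffun i => if i == k then v else x i].

Lemma happy_lonely (n M : nat) (y : {ffun 'I_M -> 'I_n}) :
  happy_set y = lonely finset.setT y.
Proof.
apply/setP => i; rewrite !inE.
by apply: eq_forallb => j; rewrite !inE.
Qed.

Lemma lonelyP (n M : nat) (A : {set 'I_M}) (y : {ffun 'I_M -> 'I_n}) i :
  reflect (i \in A /\ forall j, j \in A -> j != i -> y i != y j)
          (i \in lonely A y).
Proof.
rewrite inE; apply: (iffP andP) => -[iA].
  by move=> /forall_inP h; split => // j jA ji; move: (h j jA); rewrite ji.
move=> h; split => //; apply/forall_inP => j jA; apply/implyP; exact: h.
Qed.

Lemma eq_lonely (n M : nat) (A : {set 'I_M}) (y z : {ffun 'I_M -> 'I_n}) :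
  {in A, y =1 z} -> lonely A y = lonely A z.
Proof.
move=> yz; apply/setP => i; apply/lonelyP/lonelyP => -[iA h]; split=> // j jA.
  by rewrite -!yz //; exact: h.
by rewrite !yz //; exact: h.
Qed.

Lemma lonely_card (n M : nat) (A : {set 'I_M}) (y : {ffun 'I_M -> 'I_n}) :
  (#|y @: lonely A y| = #|lonely A y|)%N.
Proof.
apply: card_in_imset => i j /lonelyP[_ hi] /lonelyP[jA _] yij.
apply/eqP; case: (eqVneq i j) => // ij.
by move: (hi j jA); rewrite eq_sym ij yij eqxx => /(_ isT).
Qed.

(** A newcomer can only destroy the loneliness of others, and is at most one
additional lonely particle. *)
Lemma lonely_setU1_le (n M : nat) (A : {set 'I_M}) (y : {ffun 'I_M -> 'I_n}) k :
  (#|lonely (k |: A) y| <= #|lonely A y|.+1)%N.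
Proof.
apply: (@leq_trans #|k |: lonely A y|); last by rewrite cardsU1; case: (_ \notin _).
apply/subset_leq_card/fintype.subsetP => i /lonelyP[].
rewrite !inE => /orP[/eqP->|iA] h; first by rewrite eqxx.
apply/orP; right; rewrite iA /=; apply/forall_inP => j jA; apply/implyP => ji.
by apply: h => //; rewrite !inE jA orbT.
Qed.

(** Landing on a lonely particle makes that particle lose its status, and the
newcomer does not get it either. *)
Lemma lonely_setU1_lt (n M : nat) (A : {set 'I_M}) (y : {ffun 'I_M -> 'I_n}) k :
  k \notin A -> y k \in y @: lonely A y ->
  (#|lonely (k |: A) y| < #|lonely A y|)%N.
Proof.
move=> kA /imsetP[i iL yki]; have /lonelyP[iA hi] := iL.
have ik : i != k by apply: contraNneq kA => <-.
apply/proper_card/properP; split; last first.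
  exists i => //; apply/lonelyP => -[_ /(_ k)].
  by rewrite setU11 eq_sym ik yki eqxx => /(_ isT isT).
apply/fintype.subsetP => j /lonelyP[].
rewrite !inE => /orP[/eqP->|jA] h.
  by move: (h i); rewrite !inE iA orbT ik yki eqxx => /(_ isT isT).
rewrite jA /=; apply/forall_inP => l lA; apply/implyP => lj.
by apply: h => //; rewrite !inE lA orbT.
Qed.

Lemma lonely_inj (n M : nat) (A : {set 'I_M}) (y : {ffun 'I_M -> 'I_n}) :
  {in A &, injective y} -> lonely A y = A.
Proof.
move=> inj; apply/setP => i; apply/lonelyP/idP => [[]//|iA]; split => // j jA.
by apply: contraNneq => /inj ->.
Qed.

(** Redrawing one coordinate of a uniform placement does not change its law:
exchanging the old and the new value of that coordinate is an involution. This
lets the particles be exposed one at a time. *)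
Lemma sum_resample (R : realType) (n M : nat) (k : 'I_M)
    (F : {ffun 'I_M -> 'I_n} -> R) :
  \sum_x \sum_v F (move_to x k v) = n%:R * \sum_x F x.
Proof.
rewrite pair_big /=.
pose s (p : {ffun 'I_M -> 'I_n} * 'I_n) := (move_to p.1 k p.2, p.1 k).
have sK : involutive s.
  move=> [x v]; rewrite /s /=; congr (_, _); last by rewrite ffunE eqxx.
  by apply/ffunP => i; rewrite !ffunE; case: eqP => // ->.
rewrite (reindex_inj (inv_inj sK)) /=.
rewrite (eq_bigr (fun p => F p.1)); last first.
  move=> [x v] _ /=; congr F; apply/ffunP => i.
  by rewrite !ffunE; case: eqP => // ->.
rewrite -(pair_big xpredT xpredT (fun x (v : 'I_n) => F x)) /= mulr_sumr.
by apply: eq_bigr => x _; rewrite sumr_const card_ord mulr_natl.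
Qed.

(** A bound 1 + x + c x^2 for the exponential improves under squaring at x / 2,
since c becomes (1 + 2 c) / 4 up to a cubic term. The fixed point of this map is
1 / 2, so a few iterations turn a crude constant into one close to the optimal
1 / 2. *)
Lemma expR_quad_double (R : realType) (c c' : R) : 1 / 2 <= c -> c <= 11 / 10 ->
  (1 + 2 * c) / 4 + 29 / 10000 <= c' ->
  (forall x : R, - (1 / 100) <= x -> x <= 1 / 100 -> expR x <= 1 + x + c * x ^+ 2) ->
  forall x : R, - (1 / 100) <= x -> x <= 1 / 100 -> expR x <= 1 + x + c' * x ^+ 2.
Proof.
move=> c0 c1 cc' h x x0 x1.
have y0 : - (1 / 100) <= x / 2 by lra.
have y1 : x / 2 <= 1 / 100 by lra.
have -> : expR x = expR (x / 2) ^+ 2 by rewrite -expRM_natl; congr expR; field.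
apply: (@le_trans _ _ ((1 + x / 2 + c * (x / 2) ^+ 2) ^+ 2)).
  by rewrite lerXn2r ?nnegrE ?expR_ge0 ?h //; have := expR_ge0 (x / 2); have := h _ y0 y1; lra.
have -> : (1 + x / 2 + c * (x / 2) ^+ 2) ^+ 2 =
  1 + x + x ^+ 2 * ((1 + 2 * c) / 4 + c * x / 4 + (c * x) ^+ 2 / 16) by field.
have cx0 : - (11 / 1000) <= c * x by nra.
have cx1 : c * x <= 11 / 1000 by nra.
rewrite lerD2l mulrC ler_wpM2r ?sqr_ge0 //; nra.
Qed.

(** The constant 51 / 100 is close to the variance factor 1 / 2 of a fair sign;
it has to be, because the final constant in [short_time] must exceed 1. *)
Lemma expR_le_quad (R : realType) (x : R) : - (1 / 100) <= x -> x <= 1 / 100 ->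
  expR x <= 1 + x + 51 / 100 * x ^+ 2.
Proof.
have h0 (y : R) : - (1 / 100) <= y -> y <= 1 / 100 -> expR y <= 1 + y + 1011 / 1000 * y ^+ 2.
  move=> y0 y1.
  have e0 := expR_gt0 y.
  have : 1 - y <= (expR y)^-1 by rewrite -expRN; exact: expR_ge1Dx.
  have : 0 < 1 - y by lra.
  move=> p q.
  have : expR y <= (1 - y)^-1.
    by rewrite -[leLHS]invrK lef_pV2 // posrE ?invr_gt0.
  move/le_trans; apply.
  by rewrite -div1r ler_pdivrMr //; nra.
move: x; apply: (@expR_quad_double _ (514 / 1000)); [lra..|].
apply: (@expR_quad_double _ (522 / 1000)); [lra..|].
apply: (@expR_quad_double _ (538 / 1000)); [lra..|].
apply: (@expR_quad_double _ (570 / 1000)); [lra..|].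
apply: (@expR_quad_double _ (633 / 1000)); [lra..|].
apply: (@expR_quad_double _ (759 / 1000)); [lra..|].
by apply: (@expR_quad_double _ (1011 / 1000)); [lra..|].
Qed.

(** With S lonely particles, the number of lonely particles increases by at most
1, and decreases by 1 with probability S / n. The comparison with a step that is
+1 with probability 1 - S / n and -1 with probability S / n gives a mean
1 - 2 S / n and a second moment 1. *)
Lemma sum_vertex_lonely (R : realType) (n M : nat) (A : {set 'I_M})
    (y : {ffun 'I_M -> 'I_n}) (k : 'I_M) (th : R) :
  k \notin A -> 0 <= th -> th <= 1 / 100 ->
  \sum_(v : 'I_n) expR (th * #|lonely (k |: A) (move_to y k v)|%:R) <=
  n%:R * expR (th * #|lonely A y|%:R
     + (th * (1 - 2 * #|lonely A y|%:R / n%:R) + 51 / 100 * th ^+ 2)).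
Proof.
move=> kA th0 th1; set S := #|lonely A y|.
have n0 : (0 < n)%N := leq_ltn_trans (leq0n _) (ltn_ord (y k)).
have n0R : 0 < n%:R :> R by rewrite ltr0n.
have lonu v : lonely A (move_to y k v) = lonely A y.
  by apply: eq_lonely => i iA; rewrite ffunE; case: eqP => // ik; rewrite -ik iA in kA.
have pt v : expR (th * #|lonely (k |: A) (move_to y k v)|%:R) <=
    expR (th * S%:R) * (if v \in y @: lonely A y then expR (- th) else expR th).
  rewrite -(fun_if expR) -expRD ler_expR; case: ifPn => vin.
    have := @lonely_setU1_lt n M A (move_to y k v) k kA.
    rewrite lonu ffunE eqxx.
    have -> : move_to y k v @: lonely A y = y @: lonely A y.
      apply: eq_in_imset => i /lonelyP[iA _]; rewrite ffunE; case: eqP => // ik.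
      by rewrite -ik iA in kA.
    move=> /(_ vin); rewrite -/S => lt.
    have : (#|lonely (k |: A) (move_to y k v)|.+1%:R <= S%:R :> R) by rewrite ler_nat.
    by rewrite -natr1; nra.
  have := @lonely_setU1_le n M A (move_to y k v) k; rewrite lonu -/S => le.
  have : (#|lonely (k |: A) (move_to y k v)|%:R <= S.+1%:R :> R) by rewrite ler_nat.
  by rewrite -natr1; nra.
apply: le_trans (ler_sum _ (fun v _ => pt v)) _.
rewrite -mulr_sumr (expRD (th * S%:R)) [leRHS]mulrCA ler_wpM2l ?expR_ge0//.
rewrite (bigID (mem (y @: lonely A y))) /=.
rewrite (eq_bigr (fun=> expR (- th))) => [|v ->//].
rewrite sumr_const lonely_card -/S.
rewrite (eq_bigr (fun=> expR th)) => [|v /negbTE ->//].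
rewrite sumr_const.
have -> : #|[pred v | v \notin y @: lonely A y]| = (n - S)%N.
  have : (S + #|[pred v | v \notin y @: lonely A y]| = n)%N; last by lia.
  apply: etrans (etrans (cardC (mem (y @: lonely A y))) (card_ord n)).
  by rewrite lonely_card -/S; congr addn; apply: eq_card.
have Sn : (S <= n)%N.
  by rewrite /S -lonely_card; apply: leq_trans (max_card _) _; rewrite card_ord.
rewrite -[expR (- th) *+ _]mulr_natl -[expR th *+ _]mulr_natl natrB //.
have eth : expR th <= 1 + th + 51 / 100 * th ^+ 2 by apply: expR_le_quad; lra.
have emth : expR (- th) <= 1 - th + 51 / 100 * th ^+ 2.
  by rewrite -[th ^+ 2]sqrrN; apply: expR_le_quad; lra.
have S0 : 0 <= S%:R :> R by rewrite ler0n.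
have SnR : S%:R <= n%:R :> R by rewrite ler_nat.
apply: (@le_trans _ _ (n%:R * (1 + (th * (1 - 2 * S%:R / n%:R) + 51 / 100 * th ^+ 2)))).
  have -> : n%:R * (1 + (th * (1 - 2 * S%:R / n%:R) + 51 / 100 * th ^+ 2)) =
    S%:R * (1 - th + 51/100 * th^+2) + (n%:R - S%:R) * (1 + th + 51/100*th^+2).
    by field; rewrite gt_eqF.
  by apply: lerD; apply: ler_wpM2l => //; lra.
by rewrite ler_wpM2l ?expR_ge1Dx // ltW.
Qed.

(** Each additional particle multiplies the exponent by 1 - 2 / n: the number of
lonely particles relaxes towards n / 2 at rate 2 / n per particle placed. Hence
the induction runs over all exponents at once, with the last particle averaged
first. *)
Lemma sum_place_lonely (R : realType) (n M : nat)
    (st : state n M) (r : seq 'I_M) (th : R) :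
  (2 <= n)%N -> {in st.2 &, injective st.1} ->
  uniq r -> {in r, forall k, k \notin st.2} ->
  0 <= th -> th <= 1 / 100 ->
  \sum_(x : {ffun 'I_M -> 'I_n})
     expR (th * (#|lonely (st.2 :|: [set k in r])%SET (place st x)|%:R - n%:R / 2))
  <= n%:R ^+ M * expR (th * (1 - 2 / n%:R) ^+ size r * (#|st.2|%:R - n%:R / 2)
                      + 51 / 100 * th ^+ 2 * (size r)%:R).
Proof.
move=> n2 inj; have n0R : 0 < n%:R :> R by rewrite ltr0n; lia.
have n2R : 2 <= n%:R :> R by rewrite (ler_nat _ 2).
have [nV0 nV1] : 0 <= 2 / n%:R :> R /\ 2 / n%:R <= 1 :> R.
  by rewrite divr_ge0 ?ler0n//= ler_pdivrMr // mul1r.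
elim: r th => [|k r IH] th /=.
  move=> _ _ _ _; rewrite expr0 mulr1 mulr0 addr0.
  have -> : st.2 :|: [set k in [::]] = st.2.
    by apply/setP => i; rewrite !inE orbF.
  rewrite (eq_bigr (fun=> expR (th * (#|st.2|%:R - n%:R / 2)))); last first.
    move=> x _; rewrite lonely_inj // => i j iH jH; rewrite !ffunE iH jH.
    exact: inj.
  by rewrite sumr_const card_ffun !card_ord -natrX -[leLHS]mulr_natl.
move=> /andP[kr ur] rH th0 th1.
have kH : k \notin st.2 by apply: rH; rewrite inE eqxx.
pose A := st.2 :|: [set k in r].
have kA : k \notin A by rewrite !inE negb_or kH kr.
have -> : st.2 :|: [set k0 in k :: r] = k |: A.
  by apply/setP => i; rewrite !inE orbCA.
rewrite -(@ler_pM2l _ n%:R) // -(sum_resample k).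
have plu x v : place st (move_to x k v) = move_to (place st x) k v.
  apply/ffunP => i; rewrite !ffunE; case: eqP => [->|//].
  by rewrite (negbTE kH).
have step x : \sum_(v : 'I_n)
    expR (th * (#|lonely (k |: A) (place st (move_to x k v))|%:R - n%:R / 2)) <=
   n%:R * (expR (51 / 100 * th ^+ 2) *
     expR (th * (1 - 2 / n%:R) * (#|lonely A (place st x)|%:R - n%:R / 2))).
  under eq_bigr do rewrite plu mulrBr expRD.
  rewrite -mulr_suml.
  apply: le_trans (ler_wpM2r (expR_ge0 _) (sum_vertex_lonely (place st x) kA th0 th1)) _.
  rewrite -[leLHS]mulrA -!expRD ler_wpM2l ?ler0n // ler_expR le_eqVlt.
  apply/orP; left; apply/eqP.
  by field; rewrite gt_eqF.
apply: le_trans (ler_sum _ (fun x _ => step x)) _.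
rewrite -mulr_sumr -mulr_sumr ler_pM2l //.
have [th'0 th'1] : 0 <= th * (1 - 2 / n%:R) /\ th * (1 - 2 / n%:R) <= 1 / 100.
  by split; nra.
apply: le_trans (ler_wpM2l (expR_ge0 _) (IH _ ur _ th'0 th'1)) _.
  by move=> j jr; apply: rH; rewrite inE jr orbT.
rewrite mulrCA ler_wpM2l ?exprn_ge0 ?ler0n// -expRD ler_expR.
have sq : (th * (1 - 2 / n%:R)) ^+ 2 * (size r)%:R <= th ^+ 2 * (size r)%:R.
  by rewrite ler_wpM2r // lerXn2r ?nnegrE//; nra.
rewrite (exprS _ (size r)) -[(size r).+1%:R]natr1.
set p : R := 1 - 2 / n%:R in sq *; set q : R := p ^+ size r.
set s : R := (size r)%:R in sq *; set X : R := #|_|%:R - n%:R / 2.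
by rewrite mulrA; lra.
Qed.

(** * The number of unhappy particles after one round *)

Definition step (n M : nat) (st : state n M) (x : {ffun 'I_M -> 'I_n}) :
    state n M :=
  (place st x, happy_set (place st x)).

Definition mean (R : realType) (n M : nat) (h : state n M -> R) (st : state n M) :
    R :=
  (\sum_x h (step st x)) / n%:R ^+ M.

Definition unhappy (n M : nat) (st : state n M) : nat := #|~: st.2|.

(** The only property of reachable states that the estimates need: happy
particles sit on distinct vertices. *)
Definition valid (n M : nat) (st : state n M) : Prop :=
  {in st.2 &, injective st.1}.

Definition start (n M : nat) (v0 : 'I_n) : state n M :=
  ([ffun=> v0], finset.set0).

Lemma valid_start (n M : nat) (v0 : 'I_n) : valid (start M v0).
Proof. by move=> i j; rewrite inE. Qed.

Lemma unhappy_start (n M : nat) (v0 : 'I_n) : unhappy (start M v0) = M.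
Proof. by rewrite /unhappy /= finset.setC0 cardsT card_ord. Qed.

Lemma valid_step (n M : nat) (st : state n M) x : valid (step st x).
Proof.
move=> i j; rewrite /= happy_lonely => /lonelyP[_ hi] /lonelyP[jA _] yij.
apply/eqP; case: (eqVneq i j) => // ij.
by move: (hi j jA); rewrite eq_sym ij yij eqxx => /(_ isT).
Qed.

(** With q = (1 - 2 / n)^u, the mean of the next number of happy particles minus
n / 2 is at most q times its present value, and the u jumps contribute at most
u to the variance. *)
Lemma mean_expR_unhappy (R : realType) (n M : nat) (st : state n M) (th : R) :
  (2 <= n)%N -> valid st -> 0 <= th -> th <= 1 / 100 ->
  mean (fun s => expR (- (th * (unhappy s)%:R))) st <=
  expR (- (th * (M%:R - n%:R / 2))
        + th * (1 - 2 / n%:R) ^+ unhappy st * (M%:R - (unhappy st)%:R - n%:R / 2)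
        + 51 / 100 * th ^+ 2 * (unhappy st)%:R).
Proof.
move=> n2 inj th0 th1.
have n0R : 0 < n%:R ^+ M :> R by rewrite exprn_gt0// ltr0n; lia.
have eM (A : {set 'I_M}) : #|A|%:R = M%:R - #|~: A|%:R :> R.
  by apply/eqP; rewrite eq_sym subr_eq -natrD cardsC card_ord.
rewrite /mean ler_pdivrMr // [leRHS]mulrC.
have us : uniq (enum (mem (~: st.2))) by exact: enum_uniq.
have notH : {in enum (mem (~: st.2)), forall k, k \notin st.2}.
  by move=> k; rewrite mem_enum /= inE.
have := sum_place_lonely n2 inj us notH th0 th1.
have -> : st.2 :|: [set k in enum (mem (~: st.2))] = finset.setT.
  by apply/setP => i; rewrite !inE mem_enum /= !inE orbN.
have -> : size (enum (mem (~: st.2))) = unhappy st by rewrite -cardE.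
rewrite [#|st.2|%:R]eM -/(unhappy st) => h.
rewrite (eq_bigr (fun x => expR (th * (#|lonely finset.setT (place st x)|%:R - n%:R / 2))
   * expR (- (th * (M%:R - n%:R / 2))))) => [|x _]; last first.
  rewrite -expRD /unhappy /= -happy_lonely (eM (happy_set _)); congr expR; ring.
rewrite -mulr_suml; apply: le_trans (ler_wpM2r (expR_ge0 _) h) _.
rewrite -[leLHS]mulrA -expRD ler_wpM2l ?exprn_ge0// ler_expR le_eqVlt.
by apply/orP; left; apply/eqP; ring.
Qed.

(** For eps >= 0 half of the drift is given up, so that one formula covers both
u < eps n / 2 and u >= eps n / 2 in [exponent_small]. *)
Definition drift (R : realType) (eps : R) : R := if 0 <= eps then eps / 2 else eps.

Lemma bernoulli_pow (R : realType) (x : R) u : 0 <= x -> x <= 1 ->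
  1 - x * u%:R <= (1 - x) ^+ u.
Proof.
move=> x0 x1; elim: u => [|u IH]; first by rewrite mulr0 subr0.
rewrite exprS -natr1; have u0 : 0 <= u%:R :> R by [].
apply: (@le_trans _ _ ((1 - x) * (1 - x * u%:R))); first by nra.
by rewrite ler_wpM2l //; lra.
Qed.

Lemma pow_le_expR (R : realType) (x : R) u : 0 <= x -> x <= 1 ->
  (1 - x) ^+ u <= expR (- (x * u%:R)).
Proof.
move=> x0 x1; rewrite -mulNr expRM_natr lerXn2r ?nnegrE ?expR_ge0 ?expR_ge1Dx //.
by lra.
Qed.

(** The power is at least about exp(- 2), which is larger than 1 / 16. *)
Lemma pow_ge_16 (R : realType) (n u : nat) : (40 <= n)%N -> (u <= n)%N ->
  1 / 16 <= (1 - 2 / n%:R) ^+ u :> R.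
Proof.
move=> n40 un.
have nR : 40 <= n%:R :> R by rewrite (ler_nat _ 40).
have unR : u%:R <= n%:R :> R by rewrite ler_nat.
have u0 : 0 <= u%:R :> R by [].
have n0 : 0 < n%:R :> R by lra.
have b : expR (- (9 / 4 / n%:R)) <= 1 - 2 / n%:R :> R.
  have p : 0 < 1 - 2 / n%:R :> R by rewrite subr_gt0 ltr_pdivrMr //; lra.
  rewrite expRN -[leRHS]invrK lef_pV2 ?posrE ?expR_gt0 ?invr_gt0 //.
  apply: le_trans (expR_ge1Dx _).
  rewrite -div1r ler_pdivrMr // -subr_ge0.
  have -> : (1 + 9 / 4 / n%:R) * (1 - 2 / n%:R) - 1 = (n%:R - 18) / (4 * n%:R ^+ 2) :> R.
    by field; rewrite gt_eqF.
  by apply: divr_ge0; [lra | nra].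
apply: (@le_trans _ _ (expR (- (9 / 4 / n%:R)) ^+ u)); last first.
  by rewrite lerXn2r ?nnegrE ?expR_ge0 //; apply: le_trans b; exact: expR_ge0.
rewrite -expRM_natr.
apply: (@le_trans _ _ (expR (- (1 / 4) * 9%:R))).
  rewrite expRM_natr; apply: (@le_trans _ _ ((3 / 4) ^+ 9)); first by lra.
  rewrite lerXn2r ?nnegrE ?expR_ge0 //; have := @expR_ge1Dx R (- (1 / 4)); lra.
rewrite ler_expR.
have : u%:R / n%:R <= 1 :> R by rewrite ler_pdivrMr // mul1r.
have -> : - (9 / 4 / n%:R) * u%:R = - (9 / 4) * (u%:R / n%:R) :> R by ring.
lra.
Qed.

Lemma expRN_le_half (R : realType) (y : R) : 0 <= y -> y <= 1 ->
  expR (- y) <= 1 - y / 2.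
Proof.
move=> y0 y1; rewrite expRN -div1r ler_pdivrMr ?expR_gt0 //.
have := expR_ge1Dx y; nra.
Qed.

(** The left side is - th u + th (1 - q) (u - eps n / 2) with
q = (1 - 2 / n)^u. According to the sign of the last factor, this needs the
upper bound 2 u / n or the lower bound u / n for 1 - q. *)
Lemma exponent_small (R : realType) (n u : nat) (eps th : R) :
  (40 <= n)%N -> u%:R <= n%:R / 40 :> R -> 0 <= th ->
  - (th * (eps * n%:R / 2)) +
    th * (1 - 2 / n%:R) ^+ u * (eps * n%:R / 2 - u%:R) <=
  - (th * u%:R * (1 + drift eps - 2 * u%:R / n%:R)).
Proof.
move=> n40 un th0.
have nR : 40 <= n%:R :> R by rewrite (ler_nat _ 40).
have n0 : 0 < n%:R :> R by lra.
have u0 : 0 <= u%:R :> R by [].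
have x0 : 0 <= 2 / n%:R :> R by rewrite divr_ge0.
have x1 : 2 / n%:R <= 1 :> R by rewrite ler_pdivrMr //; lra.
have q1 := bernoulli_pow u x0 x1.
have q2 := pow_le_expR u x0 x1.
have y1 : 2 / n%:R * u%:R <= 1 / 20 :> R.
  by rewrite mulrAC ler_pdivrMr //; lra.
have y0 : 0 <= 2 / n%:R * u%:R :> R by exact: mulr_ge0.
have q3 : (1 - 2 / n%:R) ^+ u <= 1 - (2 / n%:R * u%:R) / 2 :> R.
  by apply: (le_trans q2); apply: expRN_le_half => //; lra.
set q := _ ^+ u in q1 q3 *; clearbody q; clear q2.
set y : R := 2 / n%:R * u%:R in q1 q3 y0 y1.
have yn : u%:R = y * n%:R / 2 by rewrite /y; field; rewrite gt_eqF.
have -> : 2 * u%:R / n%:R = y by rewrite /y; field; rewrite gt_eqF.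
clearbody y; rewrite yn in un *.
have thn : 0 <= th * n%:R / 2 by rewrite divr_ge0 ?mulr_ge0 // ltW.
rewrite -subr_ge0.
have -> : - (th * (y * n%:R / 2) * (1 + drift eps - y)) -
  (- (th * (eps * n%:R / 2)) + th * q * (eps * n%:R / 2 - y * n%:R / 2)) =
  (th * n%:R / 2) * ((1 - q) * (eps - y) - y * (drift eps - y)) by ring.
apply: mulr_ge0 => //; rewrite /drift.
have [ey|ye] := leP eps y.
  have : 0 <= (q - (1 - y)) * (y - eps) by apply: mulr_ge0; lra.
  case: ifP => e0; last by lra.
  have : 0 <= y * eps by exact: mulr_ge0.
  lra.
have e0 : 0 <= eps by lra.
rewrite e0.
have : 0 <= (1 - q - y / 2) * (eps - y) by apply: mulr_ge0; lra.
have : 0 <= y * y by exact: mulr_ge0.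
lra.
Qed.

(** For u of order n the expansion in u / n is useless, but a positive proportion
of the u particles remains unhappy, and this outweighs the other terms. *)
Lemma exponent_large (R : realType) (n u : nat) (eps th : R) :
  (40 <= n)%N -> n%:R / 40 <= u%:R :> R -> (u <= n)%N -> 
  - (1 / 1280) <= eps -> 0 <= th -> th <= 1 / 100 ->
  - (th * (eps * n%:R / 2)) +
    th * (1 - 2 / n%:R) ^+ u * (eps * n%:R / 2 - u%:R) + 51 / 100 * th ^+ 2 * u%:R <=
  - (th * n%:R / 1280).
Proof.
move=> n40 nu un e0 th0 th1.
have nR : 40 <= n%:R :> R by rewrite (ler_nat _ 40).
have n0 : 0 < n%:R :> R by lra.
have u0 : 0 <= u%:R :> R by [].
have x0 : 0 <= 2 / n%:R :> R by rewrite divr_ge0.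
have x1 : 2 / n%:R <= 1 :> R by rewrite ler_pdivrMr //; lra.
have q1 : (1 - 2 / n%:R) ^+ u <= 1 :> R by rewrite exprn_ile1 //; lra.
have q16 := @pow_ge_16 R n u n40 un.
set q := _ ^+ u in q1 q16 *; clearbody q.
rewrite -subr_ge0.
have -> : - (th * n%:R / 1280) - (- (th * (eps * n%:R / 2)) +
    th * q * (eps * n%:R / 2 - u%:R) + 51 / 100 * th ^+ 2 * u%:R) =
  th * (eps * n%:R / 2 * (1 - q) + q * u%:R - 51 / 100 * th * u%:R - n%:R / 1280) by ring.
apply: (mulr_ge0 th0).
have a1 : 1 / 16 * u%:R <= q * u%:R by rewrite ler_wpM2r.
have a2 : th * u%:R <= 1 / 100 * u%:R by rewrite ler_wpM2r.
have a3 : - (1 / 1280) * n%:R / 2 <= eps * n%:R / 2 * (1 - q).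
  have : 0 <= (1 - q) * n%:R by rewrite mulr_ge0 //; lra.
  have : 0 <= q * n%:R by rewrite mulr_ge0 //; lra.
  nra.
lra.
Qed.

(** * Extinction probabilities and sequences of exponents *)

Definition extinct_prob (R : realType) (n M t : nat) (st : state n M) : R :=
  iter t (@mean R n M) (fun s => (unhappy s == 0)%:R) st.

Lemma extinct_prob0 (R : realType) (n M : nat) (v0 : 'I_n) :
  (0 < M)%N -> extinct_prob R 0 (start M v0) = 0.
Proof. by move=> M0; rewrite /extinct_prob /= unhappy_start eqn0Ngt M0. Qed.

Lemma le_mean (R : realType) (n M : nat) (h g : state n M -> R) st :
  (forall s, valid s -> h s <= g s) -> mean h st <= mean g st.
Proof.
move=> hg; rewrite /mean ler_wpM2r ?invr_ge0 ?exprn_ge0 ?ler0n //.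
by apply: ler_sum => x _; apply: hg; exact: valid_step.
Qed.

Lemma mean_addc (R : realType) (n M : nat) (h : state n M -> R) (c : R) st :
  (0 < n)%N -> mean (fun s => h s + c) st = mean h st + c.
Proof.
move=> n0; rewrite /mean big_split /= mulrDl; congr (_ + _).
rewrite sumr_const card_ffun !card_ord -[c *+ _]mulr_natr natrX mulfK //.
by rewrite expf_neq0 // pnatr_eq0 -lt0n.
Qed.

(** The optimal constant is 1 / e < 47 / 100. *)
Lemma le_expR_47 (R : realType) (y : R) : y <= 47 / 100 * expR y.
Proof.
have h1 := @expR_ge1Dx R (y - 1).
have h2 : expR (-1) <= 47 / 100 :> R.
  have -> : -1 = 2 * - (1 / 2) :> R by field.
  rewrite expRM_natl expRN.
  have h := @expR_ge1Dx R (1 / 2).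
  have : (expR (1 / 2))^-1 <= 2 / 3 :> R.
    by rewrite -[leRHS]invrK lef_pV2 ?posrE ?expR_gt0 //; lra.
  have : 0 <= (expR (1 / 2))^-1 :> R by rewrite invr_ge0 expR_ge0.
  nra.
have : expR (y - 1) <= 47 / 100 * expR y.
  by rewrite expRD mulrC ler_wpM2r ?expR_ge0.
lra.
Qed.

(** Put z = x - L: the bounds z <= exp(0.94 z) / 2 and z^2 <= exp(0.94 z) absorb
the quadratic factor into the exponential. *)
Lemma quad_expR_le (R : realType) (L x : R) : 0 <= L -> L <= x ->
  x * (x - L) * expR (- (94 / 100 * x)) <= (L / 2 + 1) * expR (- (94 / 100 * L)).
Proof.
move=> L0 Lx.
have -> : - (94 / 100 * x) = - (94 / 100 * L) - 94 / 100 * (x - L) by ring.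
set z := x - L; have z0 : 0 <= z by rewrite subr_ge0.
rewrite expRD [leRHS]mulrC [leLHS]mulrCA ler_wpM2l ?expR_ge0 //.
rewrite expRN ler_pdivrMr ?expR_gt0 //.
have h1 := le_expR_47 (94 / 100 * z).
have h2 := le_expR_47 (47 / 100 * z).
have e2 : expR (94 / 100 * z) = expR (47 / 100 * z) ^+ 2.
  by rewrite -expRM_natl; congr expR; field.
have h3 : z ^+ 2 <= expR (94 / 100 * z).
  by rewrite e2 lerXn2r ?nnegrE ?expR_ge0 //; lra.
have -> : x = L + z by rewrite /z; ring.
have : L * z <= L * (expR (94 / 100 * z) / 2) by rewrite ler_wpM2l //; lra.
lra.
Qed.

(** The first term bounds, through [quad_expR_le] with L = kap n / 2, the
contribution of those u <= n / 40 for which kap does not pay for the damping;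
the second term is the contribution of u > n / 40. *)
Definition step_error (R : realType) (n : nat) (kap th : R) : R :=
  2 / (n%:R * th) * ((kap * n%:R / 4 + 1) * expR (- (94 / 100 * (kap * n%:R / 2))))
  + expR (- (th * n%:R / 1280)).

(** Let E be the exponent of the Laplace bound and y = u (2 th u / n - kap) the
part of the damping that kap does not cover, so that E <= - th' u + y. For
y <= 0 there is nothing to pay. For y > 0, convexity gives
exp E <= exp(- th' u) + y exp E, with E <= - 0.94 th u and
y = 2 / (n th) * x (x - L), where x = th u and L = kap n / 2. The factor
2 / (n th) in the error is what makes a sum of many errors small. *)
Lemma mean_expR_le (R : realType) (n M : nat) (eps th th' thm kap : R) st :
  (40 <= n)%N -> M%:R = (1 + eps) * n%:R / 2 -> `|eps| <= 1 / 1280 ->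
  0 < thm -> thm <= th -> th <= 1 / 100 -> 0 <= kap ->
  th' <= th * (1 + drift eps) - 51 / 100 * th ^+ 2 - kap ->
  valid st ->
  mean (fun s : state n M => expR (- (th * (unhappy s)%:R))) st <=
  expR (- (th' * (unhappy st)%:R)) + step_error n kap thm.
Proof.
move=> n40 eM epsle thm0 thm_le th1 kap0 rec val.
have th0 : 0 < th by apply: lt_le_trans thm_le.
have [el eu] : - (1 / 1280) <= eps /\ eps <= 1 / 1280.
  by move: epsle; rewrite ler_norml => /andP.
have nR : 40 <= n%:R :> R by rewrite (ler_nat _ 40).
have n0 : 0 < n%:R :> R by lra.
have uM : (unhappy st <= M)%N by rewrite -[leqRHS]card_ord max_card.
have Mn : (M <= n)%N by rewrite -(ler_nat R) eM; nra.
have un := leq_trans uM Mn.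
have n2 : (2 <= n)%N by apply: leq_trans n40.
apply: le_trans (mean_expR_unhappy n2 val (ltW th0) th1) _.
set u := unhappy st in un *.
have err1 : 0 <= 2 / (n%:R * thm) * ((kap * n%:R / 4 + 1) *
    expR (- (94 / 100 * (kap * n%:R / 2)))).
  apply: mulr_ge0; first by rewrite divr_ge0 // mulr_ge0 // ltW.
  by rewrite mulr_ge0 ?expR_ge0 // addr_ge0 // divr_ge0 // mulr_ge0.
have -> : M%:R - n%:R / 2 = eps * n%:R / 2 by rewrite eM; field.
have -> : M%:R - u%:R - n%:R / 2 = eps * n%:R / 2 - u%:R by rewrite eM; field.
have [nu|un40] := leP (n%:R / 40) (u%:R : R).
  have h := exponent_large n40 nu un el (ltW th0) th1.
  apply: (@le_trans _ _ (expR (- (thm * n%:R / 1280)))).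
    rewrite ler_expR; apply: (le_trans h).
    have : thm * n%:R <= th * n%:R by rewrite ler_wpM2r // ltW.
    by clear; lra.
  rewrite /step_error; move: (expR_ge0 (- (th' * u%:R))) err1; clear; lra.
have h := exponent_small eps n40 (ltW un40) (ltW th0).
have u0 : 0 <= u%:R :> R by [].
set y : R := u%:R * (2 * th * u%:R / n%:R - kap).
set E : R := - (th * u%:R * (1 + drift eps - 2 * u%:R / n%:R)) + 51 / 100 * th ^+ 2 * u%:R.
apply: (@le_trans _ _ (expR E)); first by rewrite ler_expR lerD2r.
have Ey : E <= - (th' * u%:R) + y.
  rewrite /E /y -subr_ge0.
  have -> : - (th' * u%:R) + u%:R * (2 * th * u%:R / n%:R - kap) -
    (- (th * u%:R * (1 + drift eps - 2 * u%:R / n%:R)) + 51 / 100 * th ^+ 2 * u%:R)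
   = u%:R * (th * (1 + drift eps) - 51 / 100 * th ^+ 2 - kap - th') by ring.
  by apply: mulr_ge0 => //; rewrite subr_ge0.
have [y0|y0] := leP y 0.
  apply: (@le_trans _ _ (expR (- (th' * u%:R)))).
    by rewrite ler_expR; apply: (le_trans Ey); rewrite gerDl.
  by rewrite lerDl; exact: addr_ge0 err1 (expR_ge0 _).
have Edec : expR E <= expR (- (th' * u%:R)) + y * expR E.
  have e1 : expR E * expR (- y) <= expR (- (th' * u%:R)).
    by rewrite -expRD ler_expR lerBlDr.
  have : expR E * (1 - y) <= expR E * expR (- y).
    by rewrite ler_wpM2l ?expR_ge0 ?expR_ge1Dx.
  by move: e1; clear; lra.
apply: (le_trans Edec); rewrite lerD2l.
have E94 : E <= - (94 / 100 * (th * u%:R)).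
  have un20 : 2 * u%:R / n%:R <= 1 / 20 :> R by rewrite ler_pdivrMr //; move: un40; clear; lra.
  have dr : - (1 / 1280) <= drift eps by move: el; rewrite /drift; clear; case: ifP => _; lra.
  have thu : 0 <= th * u%:R by rewrite mulr_ge0 // ltW.
  rewrite /E -subr_ge0.
  have -> : - (94 / 100 * (th * u%:R)) -
   (- (th * u%:R * (1 + drift eps - 2 * u%:R / n%:R)) + 51 / 100 * th ^+ 2 * u%:R) =
   (th * u%:R) * (6 / 100 + drift eps - 2 * u%:R / n%:R - 51 / 100 * th).
    by field; rewrite gt_eqF.
  by apply: (mulr_ge0 thu); move: dr un20 th1; clear; lra.
apply: (@le_trans _ _ (y * expR (- (94 / 100 * (th * u%:R))))).
  by rewrite ler_wpM2l ?ler_expR // ltW.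
set L := kap * n%:R / 2.
have L0 : 0 <= L by rewrite /L divr_ge0 ?mulr_ge0 // ltW.
have u_gt0 : 0 < u%:R :> R.
  by rewrite lt0r u0 andbT; apply: contraTneq y0 => u00; rewrite /y u00 mul0r ltxx.
have Lx : L <= th * u%:R.
  move: y0; rewrite /y pmulr_rgt0 // subr_gt0 ltr_pdivlMr // => y0.
  by rewrite /L; move: y0; clear; lra.
have ey : y = 2 / (n%:R * th) * (th * u%:R * (th * u%:R - L)).
  by rewrite /y /L; field; rewrite !gt_eqF.
rewrite ey -[leLHS]mulrA.
apply: (@le_trans _ _ (2 / (n%:R * thm) * (th * u%:R * (th * u%:R - L) *
    expR (- (94 / 100 * (th * u%:R)))))).
  apply: ler_wpM2r.
    by rewrite !mulr_ge0 ?expR_ge0 ?subr_ge0 // ltW.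
  by rewrite ler_wpM2l // lef_pV2 ?posrE ?mulr_gt0 // ler_wpM2l // ltW.
rewrite /step_error -[leLHS]addr0 lerD ?expR_ge0 // ler_wpM2l //.
  by rewrite divr_ge0 // mulr_ge0 // ltW.
apply: le_trans (quad_expR_le L0 Lx) _.
by rewrite (_ : L / 2 = kap * n%:R / 4) // /L; field.
Qed.

(** Induction on time: extinction has the function that is 1 at u = 0 and 0
elsewhere as terminal value, and this function lies below exp(- th_0 u). *)
Lemma extinct_prob_le (R : realType) (n M t : nat) (eps kap : R) (th : nat -> R) st :
  (40 <= n)%N -> M%:R = (1 + eps) * n%:R / 2 -> `|eps| <= 1 / 1280 ->
  (forall s, (s <= t)%N -> 0 < th s) -> (forall s, (s <= t)%N -> th s <= 1 / 100) ->
  (forall s, (s < t)%N -> th s.+1 <= th s) -> 0 <= kap ->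
  (forall s, (s < t)%N ->
     th s.+1 <= th s * (1 + drift eps) - 51 / 100 * th s ^+ 2 - kap) ->
  valid st ->
  extinct_prob R t st <=
  expR (- (th t * (unhappy (st : state n M))%:R)) + t%:R * step_error n kap (th t).
Proof.
move=> n40 eM epsle thpos th1 thdec kap0 rec.
have n0 : (0 < n)%N by apply: leq_trans n40.
have thm s : (s <= t)%N -> th t <= th s.
  suff h m : (s <= m)%N -> (m <= t)%N -> th m <= th s by move=> st'; exact: h.
  elim: m => [|m IH]; first by rewrite leqn0 => /eqP ->.
  rewrite leq_eqVlt => /orP[/eqP->//|sm] mt.
  by apply: le_trans (thdec _ mt) (IH _ _) => //; exact: ltnW.
suff: forall s, (s <= t)%N -> forall st : state n M, valid st ->
  extinct_prob R s st <= expR (- (th s * (unhappy st)%:R)) + s%:R * step_error n kap (th t).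
  by move=> h val; exact: (h t).
elim=> [|s IH] st' {}st val.
  rewrite /extinct_prob /= mul0r addr0; case: eqP => [->|_]; last exact: expR_ge0.
  by rewrite mulr0 oppr0 expR0.
rewrite /extinct_prob iterS.
apply: le_trans (le_mean _ (IH (ltnW st'))) _.
rewrite mean_addc // -[s.+1%:R]natr1 mulrDl mul1r addrA addrAC lerD2r.
have st_ := ltnW st'.
exact: (mean_expR_le n40 eM epsle (thpos _ (leqnn t)) (thm _ st_) (th1 _ st_) kap0
  (rec _ st')).
Qed.

(** * Extinction in a short time *)

(** Put sg = s + 200. Without damping the exponents of the critical branching
process satisfy th' = - th^2 / 2; with a small safety margin, th' = - 0.55 th^2,
which is solved by 1 / (0.55 sg). Subtracting a linear
function of sg makes th decrease faster, which leaves room for a constant term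
kap = 3 / tau^2, and its coefficient is chosen so that th is still positive, of
order 1 / tau, at the final time sg = tau. The shift by 200 keeps th below
1 / 100 at time 0 and absorbs the discretization error. *)
Definition riccati (R : realType) (tau : R) (s : nat) : R :=
  20 / 11 * ((s%:R + 200)^-1 - 3 / 4 / tau ^+ 2 * (s%:R + 200)).

Lemma riccati_ge (R : realType) (tau : R) (s : nat) :
  s%:R + 200 <= tau -> 5 / 11 / tau <= riccati tau s.
Proof.
rewrite /riccati => h; set sg : R := s%:R + 200 in h *.
have s0 : 0 <= s%:R :> R by [].
have sg0 : 0 < sg by move: s0; rewrite /sg; clear; lra.
have tau0 : 0 < tau by exact: lt_le_trans h.
have h1 : tau^-1 <= sg^-1 by rewrite lef_pV2 ?posrE.
have h2 : 3 / 4 / tau ^+ 2 * sg <= 3 / 4 / tau.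
  have -> : 3 / 4 / tau = 3 / 4 / tau ^+ 2 * tau by field; rewrite gt_eqF.
  by rewrite ler_wpM2l ?divr_ge0 ?sqr_ge0.
have -> : 5 / 11 / tau = 20 / 11 * (tau^-1 - 3 / 4 / tau) by field; rewrite gt_eqF.
by rewrite ler_wpM2l ?lerB ?divr_ge0.
Qed.

Lemma riccati_le (R : realType) (tau : R) (s : nat) :
  0 < tau -> riccati tau s <= 1 / 100.
Proof.
rewrite /riccati => tau0; set sg : R := s%:R + 200.
have sg0 : 200 <= sg by rewrite /sg lerDr.
have h1 : sg^-1 <= 1 / 200 by rewrite -div1r ler_pdivrMr; move: sg0; clear; lra.
have h2 : 0 <= 3 / 4 / tau ^+ 2 * sg.
  by rewrite mulr_ge0 ?divr_ge0 ?sqr_ge0 //; move: sg0; clear; lra.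
move: h1 h2; clear; lra.
Qed.

Lemma riccati_dec (R : realType) (tau : R) (s : nat) :
  0 < tau -> riccati tau s.+1 <= riccati tau s.
Proof.
rewrite /riccati -[s.+1%:R]natr1 => tau0.
have s0 : 0 <= s%:R :> R by [].
rewrite ler_wpM2l ?divr_ge0 //.
apply: lerB; first by rewrite lef_pV2 ?posrE; move: s0; clear; lra.
rewrite ler_wpM2l ?divr_ge0 ?sqr_ge0 //; move: s0; clear; lra.
Qed.

(** In the variables z = 1 / sg and b = 3 sg^2 / (4 tau^2), the difference of the
two sides is at least z^2 times a polynomial in z and b, which is positive for
b <= 3 / 4 and z <= 1 / 200. The
coefficient 52 / 100, larger than the 51 / 100 needed for eps >= 0, pays for a
negative drift of size at most th / 100. *)
Lemma riccati_rec (R : realType) (tau : R) (s : nat) :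
  s%:R + 200 <= tau ->
  riccati tau s.+1 <= riccati tau s - 52 / 100 * riccati tau s ^+ 2 - 3 / tau ^+ 2.
Proof.
rewrite /riccati -[s.+1%:R]natr1 addrAC => h; set sg : R := s%:R + 200 in h *.
have sg0 : 200 <= sg by rewrite /sg lerDr.
have sgp : 0 < sg by move: sg0; clear; lra.
have tau0 : 0 < tau by exact: lt_le_trans h.
set z := sg^-1.
have z0 : 0 < z by rewrite invr_gt0.
have z1 : z <= 1 / 200 by rewrite /z -div1r ler_pdivrMr //; move: sg0; clear; lra.
have h1 : (sg + 1)^-1 <= z - z ^+ 2 + z ^+ 3.
  rewrite -div1r ler_pdivrMr; last by move: sg0; clear; lra.
  have -> : (z - z ^+ 2 + z ^+ 3) * (sg + 1) = 1 + z ^+ 3.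
    by rewrite /z; field; rewrite gt_eqF.
  by rewrite lerDl exprn_ge0 // ltW.
pose b := 3 / 4 / tau ^+ 2 * sg ^+ 2.
have b0 : 0 <= b by rewrite /b mulr_ge0 ?divr_ge0 ?sqr_ge0.
have b1 : b <= 3 / 4.
  have -> : b = 3 / 4 * (sg ^+ 2 / tau ^+ 2) by rewrite /b; field; rewrite gt_eqF.
  rewrite ler_piMr // ler_pdivrMr ?exprn_gt0 // mul1r lerXn2r ?nnegrE // ltW //.
have e1 : 3 / 4 / tau ^+ 2 * sg = b * z by rewrite /b /z; field; rewrite !gt_eqF.
have e2 : 3 / 4 / tau ^+ 2 * (sg + 1) = b * z + b * z ^+ 2.
  by rewrite /b /z; field; rewrite !gt_eqF.
have e3 : 3 / tau ^+ 2 = 4 * (b * z ^+ 2) by rewrite /b /z; field; rewrite !gt_eqF.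
rewrite e1 e2 e3.
apply: (@le_trans _ _ (20 / 11 * (z - z ^+ 2 + z ^+ 3 - (b * z + b * z ^+ 2)))).
  by rewrite ler_wpM2l ?divr_ge0 // lerD2r.
clearbody b z; clear -z0 z1 b0 b1.
rewrite -subr_ge0.
have -> : 20 / 11 * (z - b * z) - 52 / 100 * (20 / 11 * (z - b * z)) ^+ 2 - 4 * (b * z ^+ 2) -
   20 / 11 * (z - z ^+ 2 + z ^+ 3 - (b * z + b * z ^+ 2)) =
   z ^+ 2 * (20 / 11) *
     ((1 + b - z) - 52 / 100 * (20 / 11) * (1 - b) ^+ 2 - 22 / 10 * b) by field.
apply: mulr_ge0; first by rewrite mulr_ge0 ?sqr_ge0 //; lra.
nra.
Qed.

Lemma expRN_le_sq (R : realType) (x : R) : 0 < x -> expR (- x) <= 2 / x ^+ 2.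
Proof.
move=> x0; rewrite expRN -div1r ler_pdivrMr ?expR_gt0 // mulrAC.
rewrite ler_pdivlMr ?exprn_gt0 // mul1r.
have := expR_ge1Dxn 1 (ltW x0); rewrite (_ : 2`! = 2)%N //; lra.
Qed.

(** Here kap n / 2 = 1.5 n / tau^2, so the errors of [extinct_prob_le] are of
order exp(- 0.94 * 1.5 n / tau^2), and n / tau^2 >= 7 leaves enough room to
absorb the factor in front of the exponential and still reach the constant
1.05. *)
Lemma short_time (R : realType) (n M t : nat) (eps tau : R) (st : state n M) :
  (40 <= n)%N -> M%:R = (1 + eps) * n%:R / 2 -> `|eps| <= 1 / 1280 ->
  10 ^+ 7 <= tau -> t%:R + 200 <= tau -> 7 * tau ^+ 2 <= n%:R ->
  (eps < 0 -> `|eps| * tau <= 1 / 300) -> valid st -> unhappy st = M ->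
  extinct_prob R t st <= expR (- (105 / 100 * (n%:R / tau ^+ 2))).
Proof.
move=> n40 eM epsle tauT ttau ntau epstau val uM.
have tau0 : 0 < tau by apply: lt_le_trans tauT; rewrite exprn_gt0.
have nR : 0 < n%:R :> R by rewrite ltr0n (leq_trans _ n40).
have lt_tau s : (s <= t)%N -> s%:R + 200 <= tau.
  by move=> st'; apply: le_trans ttau; rewrite lerD2r ler_nat.
have thge s : (s <= t)%N -> 5 / 11 / tau <= riccati tau s.
  by move=> st'; apply: riccati_ge; exact: lt_tau.
have c0 : 0 < 5 / 11 / tau by rewrite !divr_gt0.
have thpos s : (s <= t)%N -> 0 < riccati tau s.
  by move=> /thge; exact: lt_le_trans.
have rec s : (s < t)%N -> riccati tau s.+1 <=
    riccati tau s * (1 + drift eps) - 51 / 100 * riccati tau s ^+ 2 - 3 / tau ^+ 2.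
  move=> st'; have := riccati_rec (lt_tau _ (ltnW st')); move=> /le_trans; apply.
  have t0 := thpos _ (ltnW st'); have tg := thge _ (ltnW st').
  have dr : - (riccati tau s / 100) <= drift eps.
    rewrite /drift; have [e0|e0] := leP 0 eps.
      by apply: (@le_trans _ _ (0 : R)); [rewrite oppr_le0 divr_ge0 // ltW | rewrite divr_ge0].
    have := epstau e0; rewrite ltr0_norm // -ler_pdivlMr // lerNl => /(le_trans _); apply.
    rewrite lerN2.
    have -> : 1 / 300 / tau = (11 / 1500) * (5 / 11 / tau) by field; rewrite gt_eqF.
    by move: tg t0; clear; lra.
  move: dr t0; clear; move: (riccati _ _) (drift _) => x y; nra.
have kap0 : 0 <= 3 / tau ^+ 2 by rewrite divr_ge0 // sqr_ge0.
have := extinct_prob_le n40 eM epsle thpos (fun s _ => riccati_le s tau0)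
  (fun s _ => riccati_dec s tau0) kap0 rec val.
move=> /le_trans; apply; rewrite uM.
set N' := n%:R / tau ^+ 2.
have nN : n%:R = N' * tau ^+ 2 by rewrite /N'; field; rewrite gt_eqF.
have N7 : 7 <= N' by rewrite /N' ler_pdivlMr // exprn_gt0.
have N0 : 0 < N' by move: N7; clear; lra.
clearbody N'.
have tg := thge _ (leqnn t); have tp := thpos _ (leqnn t).
set th := riccati tau t in tg tp *.
have thn : 5 / 11 * (N' * tau) <= th * n%:R.
  have -> : 5 / 11 * (N' * tau) = 5 / 11 / tau * n%:R.
    by rewrite nN; field; rewrite gt_eqF.
  by rewrite ler_wpM2r // ltW.
have tauM : 10 ^+ 7 * N' <= N' * tau by rewrite mulrC ler_wpM2l // ltW.
(* th M is at least of order n / tau, hence much larger than n / tau^2. *)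
have p1 : expR (- (th * M%:R)) <= 1 / 4 * expR (- (105 / 100 * N')).
  apply: (@le_trans _ _ (expR (- 6 - 105 / 100 * N'))).
    rewrite ler_expR eM.
    have a0 : n%:R / 3 <= (1 + eps) * n%:R / 2.
      move: epsle; rewrite ler_norml => /andP[h _].
      have : 0 <= (1 / 3 + eps) * n%:R by rewrite mulr_ge0 ?ltW //; move: h; clear; lra.
      clear; lra.
    have : th * (n%:R / 3) <= th * ((1 + eps) * n%:R / 2) by rewrite ler_wpM2l // ltW.
    move: N7 thn tauM; clear; lra.
  rewrite expRD ler_wpM2r ?expR_ge0 // expRN -div1r ler_pdivrMr ?expR_gt0 //.
  have := @expR_ge1Dx R 6; clear; lra.
(* t errors 2 / (n th) add up to at most 4.4 / N', because th >= 5 / (11 tau). *)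
have p2 : t%:R * (2 / (n%:R * th) * ((3 / tau ^+ 2 * n%:R / 4 + 1) *
    expR (- (94 / 100 * (3 / tau ^+ 2 * n%:R / 2))))) <= 1 / 2 * expR (- (105 / 100 * N')).
  have -> : 3 / tau ^+ 2 * n%:R / 4 = 3 / 4 * N' by rewrite nN; field; rewrite gt_eqF.
  have -> : 94 / 100 * (3 / tau ^+ 2 * n%:R / 2) = 141 / 100 * N'.
    by rewrite nN; field; rewrite gt_eqF.
  have tt : t%:R <= tau by move: ttau; clear; lra.
  have b : t%:R * (2 / (n%:R * th)) <= 22 / 5 / N'.
    have nth0 : 0 < n%:R * th by exact: mulr_gt0.
    rewrite mulrA (ler_pdivrMr _ _ nth0) [leRHS]mulrAC (ler_pdivlMr _ _ N0).
    have : t%:R * N' <= tau * N' by rewrite ler_wpM2r // ltW.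
    move: thn; clear; lra.
  rewrite mulrA; set B : R := t%:R * _ in b *.
  have B0 : 0 <= B by rewrite /B mulr_ge0 // divr_ge0 // mulr_ge0 // ltW.
  have q0 : 0 <= 3 / 4 * N' + 1 by move: N0; clear; lra.
  (* 36 / 100 = 0.94 * 1.5 - 1.05 is the room left in the exponent. *)
  have e8 : expR (- (36 / 100 * N')) <= 1 / (8 : R).
    apply: (@le_trans _ _ (expR (- (315 / 1000)) ^+ 8)).
      by rewrite -expRM_natl ler_expR; move: N7; clear; lra.
    have : expR (- (315 / 1000)) <= 1 / (1315 / 1000) :> R.
      rewrite expRN -div1r ler_pdivrMr ?expR_gt0 //.
      have := @expR_ge1Dx R (315 / 1000); clear; lra.
    move=> h; apply: (@le_trans _ _ ((1 / (1315 / 1000)) ^+ 8)).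
      by apply: lerXn2r h; rewrite nnegrE; [exact: expR_ge0 | clear; lra].
    clear; lra.
  have -> : expR (- (141 / 100 * N')) = expR (- (36 / 100 * N')) * expR (- (105 / 100 * N')).
    by rewrite -expRD; congr expR; clear; lra.
  rewrite !mulrA ler_wpM2r ?expR_ge0 //.
  apply: (@le_trans _ _ (22 / 5 / N' * (3 / 4 * N' + 1) * (1 / 8))).
    exact: ler_pM (mulr_ge0 B0 q0) (expR_ge0 _) (ler_wpM2r q0 b) e8.
  have -> : 22 / 5 / N' * (3 / 4 * N' + 1) * (1 / 8) = 33 / 80 + 11 / 20 / N'.
    by field; rewrite gt_eqF.
  have : 11 / 20 / N' <= 7 / 80 by rewrite ler_pdivrMr //; move: N7; clear; lra.
  clear; lra.
(* The macroscopic part of the error is exponentially small in n / tau = N' tau. *)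
have p3 : t%:R * expR (- (th * n%:R / 1280)) <= 1 / 4 * expR (- (105 / 100 * N')).
  have tt : t%:R <= tau by move: ttau; clear; lra.
  have h1 : expR (- (th * n%:R / 1280)) <= expR (- (tau / 1000)) * expR (- (105 / 100 * N')).
    rewrite -expRD ler_expR.
    have : 7 * tau <= N' * tau by rewrite ler_wpM2r // ltW.
    move: thn tauM N0 tau0; clear; lra.
  apply: (@le_trans _ _ (tau * (expR (- (tau / 1000)) * expR (- (105 / 100 * N'))))).
    by rewrite ler_pM ?expR_ge0.
  rewrite mulrA ler_wpM2r ?expR_ge0 //.
  have tau1000 : 0 < tau / 1000 by move: tau0; clear; lra.
  apply: (@le_trans _ _ (tau * (2 / (tau / 1000) ^+ 2))).
    by rewrite ler_wpM2l ?expRN_le_sq // ltW.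
  have -> : tau * (2 / (tau / 1000) ^+ 2) = 2 * 1000 ^+ 2 / tau by field; rewrite gt_eqF.
  rewrite ler_pdivrMr //; move: tauT; clear; lra.
rewrite /step_error mulrDr; move: p1 p2 p3; clear; lra.
Qed.

(** * From the probability space to averages over placements *)

Lemma measure_fibers (d : measure_display) (Omega : measurableType d)
    (R : realType) (P : probability Omega R) (F : finType) (f : Omega -> F)
    (A : set Omega) (Q : pred F) :
  measurable A -> (forall q, measurable (f @^-1` [set q])) ->
  P (A `&` [set w | Q (f w)]) = (\sum_(q | Q q) P (A `&` f @^-1` [set q]))%E.
Proof.
move=> mA mf.
have -> : A `&` [set w | Q (f w)] = \bigcup_(q in [set` Q]) (A `&` f @^-1` [set q]).
  apply/seteqP; split => w /=.
    by move=> [Aw Qw]; exists (f w).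
  by move=> [q Qq [Aw ->]].
rewrite measure_fin_bigcup //.
- rewrite -(@bigfs _ _ _ _ (index_enum F)) // ?index_enum_uniq // => i _.
  by rewrite mem_index_enum.
- by move=> p q _ _ [w [[_ /= h1] [_ /= h2]]]; rewrite -h1 -h2.
- by move=> q _; exact: measurableI.
Qed.

Section Law.
Variables (d : measure_display) (Omega : measurableType d) (R : realType).
Variables (P : probability Omega R) (n M : nat) (G : 'I_M -> nat -> Omega -> 'I_n).
Hypothesis iidG : iid_uniform P G.
Variable v0 : 'I_n.

Definition row (t : nat) (w : Omega) : {ffun 'I_M -> 'I_n} := [ffun i => G i t w].

Definition process (t : nat) (w : Omega) : state n M :=
  dispersion_state v0 (fun i t => G i t w) t.

Lemma processS t w : process t.+1 w = step (process t w) (row t.+1 w).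
Proof.
rewrite /process /=; case: dispersion_state => pos H /=.
rewrite /step (_ : [ffun i => _] = place (pos, H) (row t.+1 w)) //.
by apply/ffunP => i; rewrite !ffunE.
Qed.

Definition cylinder (t k : nat) (x : nat -> {ffun 'I_M -> 'I_n}) : set Omega :=
  [set w | forall r, (t < r <= t + k)%N -> row r w = x r].

Lemma measurable_row t y : measurable (row t @^-1` [set y]).
Proof.
have [mG _ _] := iidG.
have -> : row t @^-1` [set y] = \bigcap_(i in [set: 'I_M]) (G i t @^-1` [set y i]).
  apply/seteqP; split => w /=; first by move=> <- i _; rewrite ffunE.
  by move=> h; apply/ffunP => i; rewrite ffunE; exact: h.
by apply: fin_bigcap_measurable => // i _; exact: mG.
Qed.

Lemma measurable_cylinder t k x : measurable (cylinder t k x).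
Proof.
have -> : cylinder t k x =
    \bigcap_(r in [set` iota t.+1 k]) (row r @^-1` [set x r]).
  apply/seteqP; split => w /= h r /=.
    by rewrite mem_iota addSn ltnS => ?; apply: h.
  by move=> ?; apply: h; rewrite /= mem_iota addSn ltnS.
by apply: fin_bigcap_measurable => // r _; exact: measurable_row.
Qed.

Lemma process_row_fiber t (p : state n M * {ffun 'I_M -> 'I_n}) :
  (fun w => (process t w, row t.+1 w)) @^-1` [set p] =
  (process t @^-1` [set p.1]) `&` (row t.+1 @^-1` [set p.2]).
Proof.
by apply/seteqP; split => w /=; case: p => a b /= [-> ->].
Qed.

Lemma process_fiberS t st :
  process t.+1 @^-1` [set st] =
  [set w | step (process t w) (row t.+1 w) == st].
Proof. by apply/seteqP; split => w /=; rewrite processS => /eqP. Qed.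

Lemma process0_fiber st :
  process 0 @^-1` [set st] = if st == start M v0 then setT else set0.
Proof.
case: eqP => [->|ne]; apply/seteqP; split => // w h.
by case: ne; exact: esym h.
Qed.

Lemma measurable_process t st : measurable (process t @^-1` [set st]).
Proof.
elim: t st => [|t IH] st.
  by rewrite process0_fiber; case: ifP => _; [exact: measurableT | exact: measurable0].
rewrite process_fiberS.
have -> : [set w | step (process t w) (row t.+1 w) == st] =
   \bigcup_(p in [set p : state n M * {ffun 'I_M -> 'I_n} | step p.1 p.2 == st])
     ((process t @^-1` [set p.1]) `&` (row t.+1 @^-1` [set p.2])).
  apply/seteqP; split => w /=; first by move=> h; exists (process t w, row t.+1 w).
  by move=> [p /= h [-> ->]].
apply: fin_bigcup_measurable => // p _; apply: measurableI; first exact: IH.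
exact: measurable_row.
Qed.

(** The only place where the mutual independence of the jumps is used. *)
Lemma prob_cylinder0 k x : P (cylinder 0 k x) = (n%:R^-1 ^+ (M * k))%:E.
Proof.
have [mG uG iG] := iidG.
pose s := [seq (i, r) | i <- enum 'I_M, r <- iota 1 k].
have us : uniq s by apply: allpairs_uniq; rewrite ?enum_uniq ?iota_uniq // => -[? ?] [].
have -> : cylinder 0 k x = \bigcap_(p in [set` [fset p in s]%fset])
    (G p.1 p.2 @^-1` [set x p.2 p.1]).
  apply/seteqP; split => w /=.
    move=> h [i r] /=; rewrite !inE /= => /allpairsP[[j q] /= [_]].
    by rewrite mem_iota => /h rowE [-> ->]; rewrite -rowE ffunE.
  move=> h r hr; apply/ffunP => i; rewrite ffunE; apply: (h (i, r)).
  rewrite /= !inE; apply/allpairsP; exists (i, r); split => //.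
    by rewrite mem_enum.
  by rewrite mem_iota.
have := iG [fset p in s]%fset (fun p => [set x p.2 p.1]); rewrite /= => ->.
rewrite (eq_bigr (fun=> (n%:R^-1)%:E)) => [|p _]; last exact: uG.
rewrite (perm_big s) /=; last first.
  apply: uniq_perm => //; first exact: fset_uniq.
  by move=> p; rewrite !inE.
rewrite big_const_seq count_predT size_allpairs size_iota -cardE card_ord.
by elim: (M * k)%N => [//|m IH]; rewrite iterS IH exprS EFinM.
Qed.

(** Splitting according to the state at time t and the jumps of round t + 1: the
latter, together with k later rounds, form a cylinder of k + 1 rounds after
time t. *)
Lemma process_cylinder_rec t :
  (forall k st x, P (process t @^-1` [set st] `&` cylinder t k x) =
    (P (process t @^-1` [set st]) * (n%:R^-1 ^+ (M * k))%:E)%E) ->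
  forall k st x, P (process t.+1 @^-1` [set st] `&` cylinder t.+1 k x) =
  (\sum_(p : state n M * {ffun 'I_M -> 'I_n} | step p.1 p.2 == st)
    P (process t @^-1` [set p.1]) * (n%:R^-1 ^+ (M * k.+1))%:E)%E.
Proof.
move=> IH k st x.
have mf (p : state n M * {ffun 'I_M -> 'I_n}) :
    measurable ((fun w => (process t w, row t.+1 w)) @^-1` [set p]).
  rewrite process_row_fiber; apply: measurableI; first exact: measurable_process.
  exact: measurable_row.
rewrite setIC process_fiberS.
rewrite (measure_fibers P (f := fun w => (process t w, row t.+1 w))
  (fun p => step p.1 p.2 == st) (measurable_cylinder _ _ _) mf).
apply: eq_bigr => p _; rewrite process_row_fiber.
rewrite -(IH k.+1 p.1 (fun r => if r == t.+1 then p.2 else x r)).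
congr (P _); apply/seteqP; split => w /=.
  move=> [hc [-> hr]]; split => // r /andP[tr rk].
  case: eqP => [->//|/eqP rt]; apply: hc.
  by rewrite ltn_neqAle eq_sym rt tr addSnnS.
move=> [-> hc]; split; last first.
  by split => //; have := hc t.+1; rewrite eqxx => -> //; rewrite ltnSn addnS ltnS leq_addr.
move=> r /andP[tr rk]; have := hc r; rewrite gtn_eqF // => -> //.
by rewrite (ltnW tr) -addSnnS.
Qed.

Lemma cylinder_setT t x : cylinder t 0 x = setT.
Proof. by apply/seteqP; split => // w _ r; rewrite addn0 ltnNge andNb. Qed.

(** The state at time t is independent of all later jumps. Carrying the later
rounds k through the induction on t makes the independence of the whole family
enter at time 0 only. *)
Lemma process_cylinder t k st x :
  P (process t @^-1` [set st] `&` cylinder t k x) =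
  (P (process t @^-1` [set st]) * (n%:R^-1 ^+ (M * k))%:E)%E.
Proof.
elim: t k st x => [|t IH] k st x.
  rewrite process0_fiber; case: ifP => _; last by rewrite set0I measure0 mul0e.
  by rewrite setTI prob_cylinder0 probability_setT mul1e.
rewrite (process_cylinder_rec IH) -[process t.+1 @^-1` [set st]]setIT -(cylinder_setT t.+1 x).
rewrite (process_cylinder_rec IH) ge0_sume_distrl; last first.
  by move=> p _; rewrite mule_ge0 // lee_fin exprn_ge0 // invr_ge0.
by apply: eq_bigr => p _; rewrite -muleA -EFinM -exprD -mulnDr add1n.
Qed.

(** The Markov property in backward form. *)
Lemma expectation_process t (h : state n M -> R) :
  \sum_st fine (P (process t @^-1` [set st])) * h st =
  iter t (@mean R n M) h (start M v0).
Proof.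
elim: t h => [|t IH] h.
  rewrite (bigD1 (start M v0)) //= big1 ?addr0.
    by rewrite process0_fiber eqxx probability_setT mul1r.
  by move=> st /negbTE ne; rewrite process0_fiber ne measure0 mul0r.
rewrite iterSr -IH.
have pS st : fine (P (process t.+1 @^-1` [set st])) =
    \sum_(p : state n M * {ffun 'I_M -> 'I_n} | step p.1 p.2 == st)
      fine (P (process t @^-1` [set p.1])) * n%:R^-1 ^+ M.
  rewrite -[process t.+1 @^-1` [set st]]setIT -(cylinder_setT t.+1 (fun=> [ffun=> v0])).
  rewrite (process_cylinder_rec (process_cylinder t)).
  have fin p : P (process t @^-1` [set p]) \is a fin_num.
    by apply: fin_num_measure; exact: measurable_process.
  rewrite -sum_fine => [|p _]; last by rewrite fin_numM.
  by apply: eq_bigr => p _; rewrite fineM // muln1.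
transitivity (\sum_(p : state n M * {ffun 'I_M -> 'I_n})
    fine (P (process t @^-1` [set p.1])) * n%:R^-1 ^+ M * h (step p.1 p.2)).
  rewrite (partition_big (fun p => step p.1 p.2) xpredT) //=.
  by apply: eq_bigr => st _; rewrite pS mulr_suml; apply: eq_bigr => p /eqP <-.
rewrite -(pair_big xpredT xpredT (fun s x =>
  fine (P (process t @^-1` [set s])) * n%:R^-1 ^+ M * h (step s x))) /=.
apply: eq_bigr => st _; rewrite -mulr_sumr /mean -mulrA; congr (_ * _).
by rewrite mulrC exprVn.
Qed.

Lemma prob_dispersed t :
  P [set w | unhappy (process t w) == 0%N] =
  (extinct_prob R t (start M v0))%:E.
Proof.
rewrite -[X in P X]setTI (measure_fibers P (f := process t) (fun st => unhappy st == 0%N))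
  //; last exact: measurable_process.
rewrite /extinct_prob -expectation_process -sumEFin big_mkcond /=.
apply: eq_bigr => st _; rewrite setTI; case: ifP => _; last by rewrite mulr0.
by rewrite mulr1 fineK // fin_num_measure //; exact: measurable_process.
Qed.

(** After the first round, the happy set is computed from the positions; if it is
everything, nobody moves and it stays so. At time 0 all particles are unhappy by
convention, which is why M > 0 matters. *)
Lemma dispersed_mono t t' w : (0 < M)%N -> (t <= t')%N ->
  unhappy (process t w) == 0%N -> unhappy (process t' w) == 0%N.
Proof.
move=> M0; elim: t' => [|t' IH]; first by rewrite leqn0 => /eqP ->.
rewrite leq_eqVlt => /orP[/eqP->//|tt'] h; have {h} := IH tt' h.
case: t' IH tt' => [_ _|t' _ _].
  have -> : unhappy (process 0 w) = M.
    by rewrite /unhappy /process /= finset.setC0 cardsT card_ord.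
  by rewrite eqn0Ngt M0.
have e : (process t'.+1 w).2 = happy_set (process t'.+1 w).1 by rewrite processS.
rewrite (processS t'.+1); move: e; case: (process t'.+1 w) => pos H /= e h.
have HT : H = finset.setT.
  by rewrite -[H]finset.setCK (cards0_eq (eqP h)) finset.setC0.
have pl : place (pos, H) (row t'.+2 w) = pos.
  by apply/ffunP => i; rewrite !ffunE HT inE.
by move: h; rewrite /step pl -e.
Qed.

Local Notation T w := (dispersion_time R v0 (fun i t => G i t w)).

Lemma dispersion_time_le_iff w (X : R) : 0 <= X ->
  (T w <= X%:E)%E <-> exists2 t : nat, t%:R <= X & unhappy (process t w) == 0%N.
Proof.
move=> X0; split; last first.
  move=> [t tX dt]; apply: ge_ereal_inf; exists (t%:R)%:E; last by rewrite lee_fin.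
  by exists t => //; apply/eqP.
move=> TX; apply: contrapT => nex; move: TX; apply/negP; rewrite -ltNge.
apply: (@lt_le_trans _ _ (Num.truncn X).+1%:R%:E).
  by rewrite lte_fin truncnS_gt.
apply/ereal_infP => _ [t /= dt <-]; rewrite lee_fin ler_nat ltnNge.
apply/negP => tX; apply: nex; exists t; last exact/eqP.
apply: le_trans (_ : (Num.truncn X)%:R <= X); first by rewrite ler_nat.
by rewrite truncn_le.
Qed.

Lemma dispersion_time_lt_iff w (X : R) :
  (T w < X%:E)%E <-> exists2 t : nat, t%:R < X & unhappy (process t w) == 0%N.
Proof.
split.
  move=> TX; apply: contrapT => nex; move: TX; apply/negP; rewrite -leNgt.
  apply/ereal_infP => _ [t /= dt <-]; rewrite lee_fin leNgt; apply/negP => tX.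
  by apply: nex; exists t => //; apply/eqP.
move=> [t tX dt]; apply: (@le_lt_trans _ _ (t%:R)%:E); last by rewrite lte_fin.
by apply: ereal_inf_lbound; exists t => //; apply/eqP.
Qed.

(** The infimum that defines the dispersion time is attained, and the dispersed
states are absorbing, so the event is that of being dispersed at one integer
time. *)
Lemma dispersion_time_le_prob (X : R) : (0 < M)%N -> 0 <= X -> exists m : nat,
  m%:R <= X /\ P [set w | (T w <= X%:E)%E] =
     (extinct_prob R m (start M v0))%:E.
Proof.
move=> M0 X0; exists (Num.truncn X); split; first by rewrite truncn_le.
rewrite -prob_dispersed; congr (P _); apply/seteqP; split => w /=.
  move/(dispersion_time_le_iff w X0) => [t tX]; apply: dispersed_mono => //.
  by rewrite truncn_ge_nat.
move=> h; apply/(dispersion_time_le_iff w X0); exists (Num.truncn X) => //.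
by rewrite truncn_le.
Qed.

Lemma dispersion_time_lt_prob (X : R) : (0 < M)%N -> 0 < X -> exists m : nat,
  m%:R < X /\ P [set w | (T w < X%:E)%E] =
     (extinct_prob R m (start M v0))%:E.
Proof.
move=> M0 X0.
have [m mX mmax] : exists2 m : nat, m%:R < X & forall t : nat, t%:R < X -> (t <= m)%N.
  have exX : exists t : nat, t%:R < X by exists 0%N.
  have bX t : t%:R < X -> (t <= Num.truncn X)%N.
    by move=> /ltW; rewrite truncn_ge_nat // ltW.
  by case: (ex_maxnP exX bX) => m mX mmax; exists m.
exists m; split=> //; rewrite -prob_dispersed; congr (P _); apply/seteqP; split => w /=.
  by move/dispersion_time_lt_iff => [t tX]; apply: dispersed_mono => //; exact: mmax.
by move=> h; apply/dispersion_time_lt_iff; exists m.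
Qed.
End Law.

(** * The regimes of the theorem *)

(** Apply [short_time] with tau comparable to the number m of rounds. Since
A m <= s / 5000 with s = n^(1/2), the exponent n / tau^2 is at least a large
multiple of A^2, hence of A. When m is bounded, tau is replaced by a constant,
and then A <= s is small compared with n. *)
Lemma near_critical (R : realType) (n M m : nat) (eps A s : R) (st : state n M) :
  (40 <= n)%N -> M%:R = (1 + eps) * n%:R / 2 -> `|eps| <= (10 ^+ 15)^-1 ->
  n%:R = s ^+ 2 -> 10 ^+ 12 <= s -> (0 < m)%N -> 1 <= A -> A * m%:R <= s / 5000 ->
  (eps < 0 -> `|eps| * m%:R <= 1 / 1200) -> valid st -> unhappy st = M ->
  extinct_prob R m st <= expR (- A).
Proof.
move=> n40 eM epsle ns s12 m0 A1 Am epsm val uM.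
have epsle' : `|eps| <= 1 / 1280 by apply: le_trans epsle _; clear; lra.
have m1 : 1 <= m%:R :> R by rewrite (ler_nat _ 1).
have mA : m%:R <= A * m%:R by rewrite ler_peMl.
have AA : A <= A * m%:R by rewrite ler_peMr // (le_trans _ A1).
have s0 : 0 < s by apply: lt_le_trans s12; rewrite exprn_gt0.
have key tau : 10 ^+ 7 <= tau -> m%:R + 200 <= tau -> 7 * tau ^+ 2 <= n%:R ->
   (eps < 0 -> `|eps| * tau <= 1 / 300) -> A * tau ^+ 2 <= n%:R ->
   extinct_prob R m st <= expR (- A).
  move=> h1 h2 h3 h4 h5.
  apply: le_trans (short_time n40 eM epsle' h1 h2 h3 h4 val uM) _.
  have tau0 : 0 < tau by apply: lt_le_trans h1; rewrite exprn_gt0.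
  have : A <= n%:R / tau ^+ 2 by rewrite ler_pdivlMr // exprn_gt0.
  rewrite ler_expR; move: A1; clear; lra.
have [mK|mK] := leP (10 ^+ 7 + 200) (m%:R : R).
  apply: (key (2 * m%:R)).
  - move: mK; clear; lra.
  - move: mK; clear; lra.
  - have : m%:R <= s / 5000 by apply: le_trans Am.
    rewrite ns; move: m1 s0; clear; nra.
  - by move=> /epsm; clear; lra.
  - have h : (A * m%:R) ^+ 2 <= (s / 5000) ^+ 2.
      by apply: lerXn2r Am; rewrite nnegrE; move: m1 mA s0; clear; lra.
    have h2 : A * m%:R ^+ 2 <= (A * m%:R) ^+ 2.
      rewrite exprMn ler_wpM2r ?sqr_ge0 // expr2; move: A1; clear; nra.
    rewrite ns; move: h h2 (sqr_ge0 s); clear; lra.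
(* [short_time] requires tau >= 10^7, whatever the number of rounds. *)
pose K : R := 10 ^+ 7 + 200.
have Ks : 4 * K ^+ 2 <= 5000 * s by move: s12; rewrite /K; clear; lra.
apply: (key (2 * K)).
- by rewrite /K; clear; lra.
- by move: mK; rewrite /K; clear; lra.
- rewrite ns; move: Ks s12; clear; nra.
- by move=> _; move: epsle; rewrite /K; clear; lra.
- have As : A <= s / 5000 by apply: le_trans Am.
  have A0 : 0 <= A by move: A1; clear; lra.
  have h1 : A * (4 * K ^+ 2) <= A * (5000 * s) by rewrite ler_wpM2l.
  have h2 : A * s <= s / 5000 * s by rewrite ler_wpM2r // ltW.
  have h3 : 0 < s * s by rewrite mulr_gt0.
  rewrite ns exprMn; move: h1 h2 h3; clear; move: (K ^+ 2) => k; lra.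
Qed.

(** Put a = |eps|. The exponents a (1 - 2 a)^s leave room for
kap = a th_m / 4, and after m rounds with a m <= L / 10000 they have lost only a
factor exp(- L / 1000). Writing W = exp L (1 - 2 a)^m, which is a th_m n, all
terms of [extinct_prob_le] are bounded, up to a factor L, by negative powers of
W, and W is close to exp L = eps^2 n. *)
Lemma subcritical_long (R : realType) (n M m : nat) (eps L : R) (st : state n M) :
  (40 <= n)%N -> M%:R = (1 + eps) * n%:R / 2 -> `|eps| <= (10 ^+ 15)^-1 ->
  eps < 0 -> eps ^+ 2 * n%:R = expR L -> 0 <= L -> `|eps| * m%:R <= L / 10000 ->
  valid st -> unhappy st = M ->
  extinct_prob R m st <= expR (- (12 / 100 * L)).
Proof.
move=> n40 eM epsle eps0; rewrite (ltr0_norm eps0); set a := - eps.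
have epsE : eps = - a by rewrite opprK.
rewrite epsE sqrrN => lamL L0 am val uM.
have a0 : 0 < a by rewrite oppr_gt0.
have epsle' : `|eps| <= 1 / 1280.
  by apply: le_trans epsle _; clear; lra.
have a15 : a <= (10 ^+ 15)^-1 by move: epsle; rewrite ltr0_norm.
have a1 : a <= 1 / 10000 by apply: le_trans a15 _; clear; lra.
have nR : 0 < n%:R :> R by rewrite ltr0n (leq_trans _ n40).
pose th s := a * (1 - 2 * a) ^+ s.
have p01 : 0 < 1 - 2 * a by move: a1; clear; lra.
have p1 : 1 - 2 * a <= 1 by move: a0; clear; lra.
have thpos s : 0 < th s by rewrite mulr_gt0 ?exprn_gt0.
have thle s : th s <= a.
  by rewrite /th; apply: ler_piMr (ltW a0) _; exact: exprn_ile1 (ltW p01) p1.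
have thdec s : th s.+1 <= th s.
  by rewrite /th exprSr mulrA; apply: ler_piMr p1; exact: ltW (thpos s).
have thm s : (s <= m)%N -> th m <= th s.
  move=> sm; rewrite /th ler_wpM2l ?(ltW a0) //.
  rewrite -(subnKC sm) exprD; apply: ler_piMr; first exact: exprn_ge0 (ltW p01).
  exact: exprn_ile1 (ltW p01) p1.
set q := (1 - 2 * a) ^+ m.
have q0 : 0 < q by rewrite exprn_gt0.
have qL : expR (- (L / 1000)) <= q.
  have h : expR (- (4 * a)) <= 1 - 2 * a.
    have y0 : 0 <= 4 * a by move: a0; clear; lra.
    have y1 : 4 * a <= 1 by move: a1; clear; lra.
    by have := expRN_le_half y0 y1; clear; lra.
  apply: (@le_trans _ _ (expR (- (4 * a)) ^+ m)); last first.
    by apply: lerXn2r h; rewrite nnegrE ?expR_ge0 ?ltW.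
  rewrite -expRM_natr ler_expR; move: am L0; clear; lra.
pose kap := th m * a / 4.
have kap0 : 0 <= kap by rewrite /kap divr_ge0 // mulr_ge0 // ltW.
have rec s : (s < m)%N -> th s.+1 <= th s * (1 + drift eps) - 51 / 100 * th s ^+ 2 - kap.
  move=> sm; rewrite /drift (lt_geF eps0) epsE.
  have -> : th s.+1 = th s * (1 - 2 * a) by rewrite /th exprSr mulrA.
  have h := thm _ (ltnW sm); have hle := thle s; have hp := thpos s.
  have : th m * a <= th s * a by rewrite ler_wpM2r // ltW.
  have : th s ^+ 2 <= th s * a by rewrite expr2 ler_wpM2l // ltW.
  have : 0 < th s * a by rewrite mulr_gt0.
  rewrite /kap; clear; lra.
have th1 s : th s <= 1 / 100 by apply: le_trans (thle s) _; move: a1; clear; lra.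
have := extinct_prob_le n40 eM epsle' (fun s _ => thpos s) (fun s _ => th1 s)
  (fun s _ => thdec s) kap0 rec val.
move=> /le_trans; apply; rewrite uM /step_error.
have thq : th m = a * q by [].
have nE : n%:R = expR L / a ^+ 2 by rewrite -lamL; field; rewrite gt_eqF.
have m0 : 0 <= m%:R :> R by [].
have mle : m%:R <= L / 10000 / a by rewrite ler_pdivlMr // mulrC.
have qe : expR (62 / 100 * L) * expR (36 / 100 * L) <= q * expR L.
  apply: (@le_trans _ _ (expR (- (L / 1000)) * expR L)).
    by rewrite -!expRD ler_expR; move: L0; clear; lra.
  by rewrite ler_wpM2r ?expR_ge0.
have eL : 12 / 100 * L <= expR (12 / 100 * L).
  by apply: le_trans (expR_ge1Dx _); clear; lra.
(* exp(- 0.12 L) is the target, and W is at least the 4th power of its inverse. *)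
set E12 := expR (12 / 100 * L) in eL *.
have E12_1 : 1 <= E12 by apply: le_trans (expR_ge1Dx _); move: L0; clear; lra.
have E48 : E12 ^+ 3 <= q * expR L.
  apply: le_trans qe; rewrite -expRD -expRM_natl ler_expR; move: L0; clear; lra.
have E80 : E12 ^+ 4 <= q * expR L.
  apply: le_trans qe; rewrite -expRD -expRM_natl ler_expR; move: L0; clear; lra.
clear qe.
set W := q * expR L in E48 E80.
have W1 : 1 <= W by apply: le_trans E80; rewrite exprn_ege1.
have W0 : 0 < W by exact: lt_le_trans W1.
rewrite [leRHS]expRN -/E12.
have thn : th m * n%:R = W / a by rewrite thq nE /W; field; rewrite gt_eqF.
have E0 : 0 < E12 by exact: lt_le_trans E12_1.
have EW2 : E12 ^+ 2 <= W by apply: le_trans E80; rewrite ler_weXn2l.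
have EW1 : E12 <= W by apply: le_trans E80; rewrite -[leLHS]expr1 ler_weXn2l.
(* From the initial population: th_m M is at least W / (4 a). *)
have b1 : expR (- (th m * M%:R)) <= 1 / 4 * E12^-1.
  have Mn : n%:R / 4 <= M%:R :> R.
    rewrite eM epsE.
    have : a * n%:R <= 1 / 10000 * n%:R by rewrite ler_wpM2r // ltW.
    move: nR; clear; lra.
  have h1 : th m * (n%:R / 4) <= th m * M%:R by rewrite ler_wpM2l // ltW.
  have h2 : 4 * E12 <= th m * M%:R.
    apply: le_trans h1; rewrite mulrA thn.
    have : W * 10000 <= W / a.
      apply: ler_wpM2l (ltW W0) _ _ _; rewrite -div1r (ler_pdivlMr _ _ a0).
      by move: a1; clear; lra.
    move: EW1 W0; clear; lra.
  rewrite expRN -[1 / 4]invf_div divr1 -invfM lef_pV2 ?posrE ?expR_gt0 ?mulr_gt0 //.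
  by apply: (le_trans h2); apply: le_trans (expR_ge1Dx _); clear; lra.
(* Here the factor 2 / (n th_m) = 2 a / W alone is small enough. *)
have b2 : m%:R * (2 / (n%:R * th m) * ((kap * n%:R / 4 + 1) *
     expR (- (94 / 100 * (kap * n%:R / 2))))) <= 1 / 2 * E12^-1.
  have kn0 : 0 <= kap * n%:R by rewrite mulr_ge0 // ltW.
  have h1 : (kap * n%:R / 4 + 1) * expR (- (94 / 100 * (kap * n%:R / 2))) <= 1.
    rewrite expRN ler_pdivrMr ?expR_gt0 // mul1r.
    by apply: le_trans (expR_ge1Dx _); move: kn0; clear; lra.
  have B0 : 0 <= 2 / (n%:R * th m) by rewrite divr_ge0 // mulr_ge0 // ltW.
  apply: (@le_trans _ _ (m%:R * (2 / (n%:R * th m) * 1))).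
    by rewrite ler_wpM2l // ler_wpM2l.
  have -> : m%:R * (2 / (n%:R * th m) * 1) = m%:R * a * 2 / W.
    by rewrite [n%:R * _]mulrC thn; field; rewrite !gt_eqF.
  rewrite ler_pdivrMr // [leRHS]mulrAC ler_pdivlMr //.
  have h2 : m%:R * a <= E12 / 1000.
    have : m%:R * a <= L / 10000 by rewrite mulrC.
    by move: eL L0; clear; lra.
  have h3 : m%:R * a * E12 <= E12 / 1000 * E12 by rewrite ler_wpM2r // ltW.
  by move: h3 EW2 W0; clear; lra.
(* The division by a in the bound for m is compensated by the square of a / W. *)
have b3 : m%:R * expR (- (th m * n%:R / 1280)) <= 1 / 4 * E12^-1.
  rewrite thn.
  have y0 : 0 < W / a / 1280 by have := divr_gt0 W0 a0; clear; lra.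
  apply: (@le_trans _ _ (L / 10000 / a * (2 / (W / a / 1280) ^+ 2))).
    by rewrite ler_pM ?expR_ge0 ?expRN_le_sq.
  have -> : L / 10000 / a * (2 / (W / a / 1280) ^+ 2) = L * a * (1280 ^+ 2 / 5000) / W ^+ 2.
    by field; rewrite !gt_eqF.
  rewrite ler_pdivrMr ?exprn_gt0 // [leRHS]mulrAC ler_pdivlMr //.
  have h2 : L <= 10 * E12 by move: eL L0; clear; lra.
  have a5 : a <= (10 ^+ 5)^-1 by apply: le_trans a15 _; clear; lra.
  have E10 : 0 <= 10 * E12 by move: E0; clear; lra.
  have h5 : L * a <= 10 * E12 * ((10 ^+ 5)^-1) by exact: ler_pM L0 (ltW a0) h2 a5.
  have h3 : L * a * E12 <= 10 * E12 * ((10 ^+ 5)^-1) * E12.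
    by apply: ler_wpM2r h5; exact: ltW.
  have h4 : E12 ^+ 2 <= W ^+ 2 by apply: lerXn2r EW1; rewrite nnegrE ltW.
  by move: h3 h4 (sqr_ge0 E12) (sqr_ge0 W); clear; lra.
rewrite [m%:R * (_ + _)]mulrDr; move: b1 b2 b3; clear; lra.
Qed.

(** Apply [short_time] with tau = m + 200. The constraint B eps m <= 1 with
B >= 1 gives B (eps m)^2 <= 1, that is, B eps^2 n <= n / m^2, and the constant
1.05 of [short_time] covers the passage from m to m + 200. For bounded m, tau is
a constant and the smallness of eps suffices. *)
Lemma supercritical_short (R : realType) (n M m : nat) (eps B s : R) (st : state n M) :
  (40 <= n)%N -> M%:R = (1 + eps) * n%:R / 2 -> 0 < eps -> eps <= (10 ^+ 15)^-1 ->
  n%:R = s ^+ 2 -> 10 ^+ 12 <= s -> 71 / 10 <= eps ^+ 2 * n%:R -> (0 < m)%N ->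
  1 <= B -> B * (eps * m%:R) <= 1 -> valid st -> unhappy st = M ->
  extinct_prob R m st <= expR (- (B * (eps ^+ 2 * n%:R))).
Proof.
move=> n40 eM eps0 epsle ns s12 lam m0 B1 Bm val uM.
have epsle' : `|eps| <= 1 / 1280.
  by rewrite gtr0_norm //; apply: le_trans epsle _; clear; lra.
have m1 : 1 <= m%:R :> R by rewrite (ler_nat _ 1).
have B0 : 0 <= B by move: B1; clear; lra.
have nR : 0 < n%:R :> R by rewrite ltr0n (leq_trans _ n40).
have em0 : 0 < eps * m%:R by rewrite mulr_gt0 // ltr0n.
have emB : eps * m%:R <= B * (eps * m%:R) by rewrite ler_peMl // ltW.
have em1 : eps * m%:R <= 1 by apply: le_trans emB Bm.
have key tau : 10 ^+ 7 <= tau -> m%:R + 200 <= tau -> 7 * tau ^+ 2 <= n%:R ->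
   B * eps ^+ 2 * tau ^+ 2 <= 105 / 100 ->
   extinct_prob R m st <= expR (- (B * (eps ^+ 2 * n%:R))).
  move=> h1 h2 h3 h4.
  have eneg : eps < 0 -> `|eps| * tau <= 1 / 300 by rewrite lt_gtF.
  apply: le_trans (short_time n40 eM epsle' h1 h2 h3 eneg val uM) _.
  have tau0 : 0 < tau by apply: lt_le_trans h1; rewrite exprn_gt0.
  rewrite ler_expR lerN2.
  have -> : B * (eps ^+ 2 * n%:R) = B * eps ^+ 2 * tau ^+ 2 * (n%:R / tau ^+ 2).
    by field; rewrite gt_eqF.
  by rewrite ler_wpM2r // divr_ge0 ?sqr_ge0 // ltW.
have [mK|mK] := leP (10 ^+ 7) (m%:R : R).
  have t2 : (m%:R + 200) ^+ 2 <= (1 + (10 ^+ 4)^-1) * m%:R ^+ 2 :> R.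
    have : (10 ^+ 7) * m%:R <= m%:R * m%:R :> R by rewrite ler_wpM2r.
    move: mK m1; clear; move: (m%:R) => x; lra.
  apply: (key (m%:R + 200)) => //.
  - by move: mK; clear; lra.
  - have h : (eps ^+ 2 * n%:R) * m%:R ^+ 2 <= n%:R.
      have -> : (eps ^+ 2 * n%:R) * m%:R ^+ 2 = n%:R * (eps * m%:R) ^+ 2 by ring.
      by apply: ler_piMr (ltW nR) _; exact: exprn_ile1 (ltW em0) em1.
    have h2 : 71 / 10 * m%:R ^+ 2 <= (eps ^+ 2 * n%:R) * m%:R ^+ 2.
      by rewrite ler_wpM2r // sqr_ge0.
    by move: h h2 t2 (sqr_ge0 (m%:R : R)); clear; lra.
  - have h : B * eps ^+ 2 * m%:R ^+ 2 <= 1.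
      have -> : B * eps ^+ 2 * m%:R ^+ 2 = B * (eps * m%:R) * (eps * m%:R) by ring.
      by apply: mulr_ile1 => //; rewrite ?mulr_ge0 // ltW.
    have h2 : B * eps ^+ 2 * (m%:R + 200) ^+ 2 <=
        B * eps ^+ 2 * ((1 + (10 ^+ 4)^-1) * m%:R ^+ 2).
      by rewrite ler_wpM2l // mulr_ge0 ?sqr_ge0.
    by apply: (le_trans h2); move: h; clear; lra.
apply: (key (10 ^+ 7 + 200)).
- by clear; lra.
- by move: mK; clear; lra.
- have h : 10 ^+ 12 * s <= s ^+ 2.
    by rewrite expr2 ler_wpM2r //; apply: le_trans s12; rewrite exprn_ge0.
  by rewrite ns; move: h s12; clear; lra.
- have Be1 : B * eps <= 1.
    apply: le_trans Bm; rewrite ler_wpM2l // ler_peMr // ltW //.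
  have h : B * eps ^+ 2 <= (10 ^+ 15)^-1.
    rewrite expr2 mulrA; apply: le_trans epsle; rewrite ler_piMl // ltW //.
  move: h; clear; move: (B * eps ^+ 2) => x; lra.
Qed.

(** With th = eps / 2 constant, the drift leaves room for kap = eps^2 / 10, and
the error per round is at most of order eps exp(- 0.047 lam) with
lam = eps^2 n. It beats the number of rounds, at most exp(lam / 10000) / (eps A),
because 0.047 > 1 / 10000. *)
Lemma supercritical_long (R : realType) (n M m : nat) (eps A s : R) (st : state n M) :
  (40 <= n)%N -> M%:R = (1 + eps) * n%:R / 2 -> 0 < eps -> eps <= (10 ^+ 15)^-1 ->
  n%:R = s ^+ 2 -> 10 ^+ 12 <= s -> 71 / 10 <= eps ^+ 2 * n%:R ->
  1 <= A -> A <= expR (eps ^+ 2 * n%:R / 10000) ->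
  A * (eps * m%:R) <= expR (eps ^+ 2 * n%:R / 10000) -> valid st -> unhappy st = M ->
  extinct_prob R m st <= A^-1.
Proof.
move=> n40 eM eps0 epsle ns s12 lam A1 AE AmE val uM.
have epsle' : `|eps| <= 1 / 1280.
  by rewrite gtr0_norm //; apply: le_trans epsle _; clear; lra.
have nR : 0 < n%:R :> R by rewrite ltr0n (leq_trans _ n40).
have A0 : 0 < A by exact: lt_le_trans A1.
have e3 : eps <= 1 / 1000 by apply: le_trans epsle _; clear; lra.
have dr : drift eps = eps / 2 by rewrite /drift ltW.
have th0 s' : (s' <= m)%N -> 0 < eps / 2 by move=> _; move: eps0; clear; lra.
have th1 s' : (s' <= m)%N -> eps / 2 <= 1 / 100 by move=> _; move: e3; clear; lra.
have rec s' : (s' < m)%N ->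
    eps / 2 <= eps / 2 * (1 + drift eps) - 51 / 100 * (eps / 2) ^+ 2 - eps ^+ 2 / 10.
  by move=> _; rewrite dr; move: (sqr_ge0 eps); clear; lra.
have kap0 : 0 <= eps ^+ 2 / 10 by rewrite divr_ge0 // sqr_ge0.
have := extinct_prob_le n40 eM epsle' th0 th1 (fun s _ => lexx _) kap0 rec val.
move=> /le_trans; apply; rewrite uM -[A^-1]div1r (ler_pdivlMr _ _ A0).
set lam' := eps ^+ 2 * n%:R in lam AE AmE.
have l0 : 0 < lam' by move: lam; clear; lra.
set E := expR (lam' / 10000) in AE AmE.
pose x := eps * n%:R.
have x12 : 10 ^+ 12 <= x.
  have s0 : 0 < s by apply: lt_le_trans s12; rewrite exprn_gt0.
  have es : 1 <= eps * s.
    rewrite leNgt; apply/negP => h; move: lam; apply/negP; rewrite -ltNge.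
    have : (eps * s) ^+ 2 <= 1 by apply: exprn_ile1 (ltW (mulr_gt0 eps0 s0)) (ltW h).
    by rewrite /lam' ns exprMn; clear; lra.
  by rewrite /x ns expr2 mulrA; apply: le_trans s12 _; rewrite ler_peMl // ltW.
have x0 : 0 < x by apply: lt_le_trans x12; rewrite exprn_gt0.
have lx : lam' <= x / 1000.
  have -> : lam' = eps * x by rewrite /lam' /x; ring.
  by have := ler_wpM2r (ltW x0) e3; clear; lra.
have m0 : 0 <= m%:R :> R by [].
(* x = eps n is much larger than lam, as eps is small. *)
have b1 : expR (- (eps / 2 * M%:R)) * A <= 1 / 10.
  apply: (@le_trans _ _ (expR (- (x / 8)) * E)).
    apply: ler_pM => //; rewrite ?expR_ge0 ?(ltW A0) // ler_expR eM.
    have h : 0 <= eps * x by rewrite mulr_ge0 // ltW.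
    by move: h x0; rewrite /x; clear; lra.
  rewrite /E -expRD.
  apply: (@le_trans _ _ (expR (- (x / 16)))).
    by rewrite ler_expR; move: lx x0; clear; lra.
  rewrite expRN -div1r (ler_pdivrMr _ _ (expR_gt0 _)).
  by have := expR_ge1Dx (x / 16); move: x12; clear; lra.
(* The margin is smallest at lam = 71 / 10: 0.67 * 100 / 132 < 6 / 10. *)
have b2 : m%:R * (2 / (n%:R * (eps / 2)) * ((eps ^+ 2 / 10 * n%:R / 4 + 1) *
     expR (- (94 / 100 * (eps ^+ 2 / 10 * n%:R / 2))))) * A <= 6 / 10.
  have -> : eps ^+ 2 / 10 * n%:R / 4 = lam' / 40 by rewrite /lam'; field.
  have -> : 94 / 100 * (eps ^+ 2 / 10 * n%:R / 2) = 47 / 1000 * lam'.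
    by rewrite /lam'; field.
  have -> : m%:R * (2 / (n%:R * (eps / 2)) * ((lam' / 40 + 1) *
     expR (- (47 / 1000 * lam')))) * A =
     (A * (eps * m%:R)) * ((1 / 10 + 4 / lam') * expR (- (47 / 1000 * lam'))).
    by rewrite /lam'; field; rewrite !gt_eqF.
  have q1 : 1 / 10 + 4 / lam' <= 67 / 100.
    have : 4 / lam' <= 57 / 100 by rewrite ler_pdivrMr //; move: lam; clear; lra.
    by clear; lra.
  have q0 : 0 <= 1 / 10 + 4 / lam'.
    by rewrite addr_ge0 // divr_ge0 // ltW.
  apply: (@le_trans _ _ (E * ((1 / 10 + 4 / lam') * expR (- (47 / 1000 * lam'))))).
    exact: ler_wpM2r (mulr_ge0 q0 (expR_ge0 _)) _ _ AmE.
  have -> : E * ((1 / 10 + 4 / lam') * expR (- (47 / 1000 * lam'))) =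
     (1 / 10 + 4 / lam') * (E * expR (- (47 / 1000 * lam'))) by ring.
  have h : E * expR (- (47 / 1000 * lam')) <= 100 / 132.
    apply: (@le_trans _ _ (expR (- (46 / 1000 * lam')))).
      by rewrite /E -expRD ler_expR; move: l0; clear; lra.
    rewrite expRN -div1r (ler_pdivrMr _ _ (expR_gt0 _)).
    by have := expR_ge1Dx (46 / 1000 * lam'); move: lam; clear; lra.
  have p0 : 0 <= E * expR (- (47 / 1000 * lam')) by exact: mulr_ge0 (expR_ge0 _) (expR_ge0 _).
  by apply: le_trans (ler_pM q0 p0 q1 h) _; clear; lra.
(* The factor 1 / eps is absorbed through eps x^2 = lam x. *)
have b3 : m%:R * expR (- (eps / 2 * n%:R / 1280)) * A <= 1 / 10.
  have -> : eps / 2 * n%:R / 1280 = x / 2560 by rewrite /x; field.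
  have -> : m%:R * expR (- (x / 2560)) * A = A * (eps * m%:R) * (expR (- (x / 2560)) / eps).
    by field; rewrite gt_eqF.
  apply: (@le_trans _ _ (E * (expR (- (x / 2560)) / eps))).
    exact: ler_wpM2r (divr_ge0 (expR_ge0 _) (ltW eps0)) _ _ AmE.
  rewrite mulrA (ler_pdivrMr _ _ eps0).
  apply: (@le_trans _ _ (expR (- (x / 5120)))).
    by rewrite /E -expRD ler_expR; move: lx x0; clear; lra.
  have y0 : 0 < x / 5120 by move: x0; clear; lra.
  apply: (le_trans (expRN_le_sq y0)).
  rewrite (ler_pdivrMr _ _ (exprn_gt0 2 y0)).
  have : 71 / 10 * x <= eps * x ^+ 2.
    have -> : eps * x ^+ 2 = lam' * x by rewrite /lam' /x; ring.
    by rewrite ler_wpM2r // ltW.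
  by move: x12; clear; lra.
rewrite /step_error [m%:R * (_ + _)]mulrDr mulrDl [(_ + _) * A]mulrDl.
move: b1 b2 b3; clear; lra.
Qed.

(** This makes e^2, the lower bound of eps^2 n outside the critical window, larger
than 71 / 10. *)
Lemma expR1_ge (R : realType) : 8 / 3 <= expR 1 :> R.
Proof.
have -> : expR 1 = expR (1 / 32) ^+ 32 :> R by rewrite -expRM_natl; congr expR; field.
have h : 33 / 32 <= expR (1 / 32) :> R by have := @expR_ge1Dx R (1 / 32); lra.
apply: (@le_trans _ _ ((33 / 32) ^+ 32)); first by lra.
by apply: lerXn2r h; rewrite nnegrE ?expR_ge0 //; lra.
Qed.

Lemma expR1_le (R : realType) : expR 1 <= 4 :> R.
Proof.
have h : 1 / 2 <= expR (- (1 / 2)) :> R by have := @expR_ge1Dx R (- (1 / 2)); lra.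
have e1 : expR (- (1 / 2)) * expR (- (1 / 2)) * expR 1 = 1 :> R.
  by rewrite -!expRD -[RHS]expR0; congr expR; field.
have p2 : 1 / 4 <= expR (- (1 / 2)) * expR (- (1 / 2)) :> R by nra.
by have := ler_wpM2r (expR_ge0 (1 : R)) p2; rewrite e1; lra.
Qed.

Lemma eventually_small (R : realType) (eps_ : nat -> R) (delta N : R) :
  eps_ @ \oo --> (0 : R) -> 0 < delta ->
  exists n0 : nat, forall n, (n0 <= n)%N -> `|eps_ n| <= delta /\ N <= n%:R.
Proof.
move=> /cvgrPdist_le h d0; have [n1 _ hn1] := h _ d0.
exists (maxn n1 (Num.truncn N).+1) => n; rewrite geq_max => /andP[n1n Nn]; split.
  by have := hn1 n n1n; rewrite sub0r normrN.
by apply: (@le_trans _ _ (Num.truncn N).+1%:R); [rewrite ltW ?truncnS_gt | rewrite ler_nat].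
Qed.

(** * Lower bounds for the dispersion time *)

Theorem theorem1p2 (R : realType) :
  exists c : R, 0 < c /\
  forall eps_ : nat -> R,
    eps_ @ \oo --> (0 : R) ->
    (forall n : nat, (1 <= n)%N -> `|eps_ n| < 1 / 9%:R) ->
  exists n0 : nat,
  forall (n : nat) (n_gt0 : (0 < n)%N) (M : nat),
    (n0 <= n)%N -> (2 <= M)%N ->
    M%:R = (1 + eps_ n) * n%:R / 2%:R :> R ->
  forall (d : measure_display) (Omega : measurableType d)
    (P : probability Omega R) (G : 'I_M -> nat -> Omega -> 'I_n),
    iid_uniform P G ->
  forall A : R, 1 <= A ->
  let eps : R := eps_ n in
  let e : R := expR 1 in
  let T (w : Omega) : \bar R :=
    dispersion_time R (Ordinal n_gt0) (fun i t => G i t w) in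
  let k0 : R := expR (c * eps ^+ 2 * n%:R) in
  [/\ eps < - (e / Num.sqrt n%:R) ->
        (P [set w | T w <= (c * `|eps|^-1 * ln (eps ^+ 2 * n%:R) / A)%:E]
           <= (expR (- A))%:E)%E,
      `|eps| <= e / Num.sqrt n%:R ->
        (P [set w | T w <= (c * Num.sqrt n%:R / A)%:E]
           <= (expR (- A))%:E)%E &
      e / Num.sqrt n%:R < eps ->
        (P [set w | T w < (eps^-1 * k0 / A)%:E]
           <= (if k0 < A then expR (- (A * eps ^+ 2 * n%:R / k0))
               else A^-1)%:E)%E].
(* c = 1 / 10000 keeps |eps| m small enough for [near_critical], and makes the
   growth of k_0 negligible in [supercritical_long]. *)
have c0 : 0 < 1 / 10000 :> R by lra.
exists (1 / 10000); split=> //.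
move=> eps_ eps0 _.
have d0 : 0 < (10 ^+ 15)^-1 :> R by rewrite invr_gt0 exprn_gt0.
have [n0 hn0] := eventually_small (10 ^+ 24) eps0 d0.
exists n0 => n n_gt0 M /hn0[epsle n24] M2 eM d Omega P G iidG A A1 eps e T k0.
have M0 : (0 < M)%N by apply: leq_trans M2.
have n40 : (40 <= n)%N.
  by rewrite -(ler_nat R); apply: le_trans n24; clear; lra.
set s : R := Num.sqrt n%:R.
have ns : n%:R = s ^+ 2 by rewrite sqr_sqrtr.
have s12 : 10 ^+ 12 <= s.
  have -> : 10 ^+ 12 = Num.sqrt (10 ^+ 24) :> R.
    have -> : 10 ^+ 24 = (10 ^+ 12) ^+ 2 :> R by rewrite -exprM.
    by rewrite sqrtr_sqr ger0_norm // exprn_ge0.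
  by rewrite ler_sqrt // exprn_ge0.
have s0 : 0 < s by apply: lt_le_trans s12; rewrite exprn_gt0.
have e83 : 8 / 3 <= e := expR1_ge R.
have e4 : e <= 4 := expR1_le R.
have A0 : 0 < A by apply: lt_le_trans A1.
have val := @valid_start n M (Ordinal n_gt0).
have uM := @unhappy_start n M (Ordinal n_gt0).
have eM' : M%:R = (1 + eps) * n%:R / 2 by [].
have lam_sq : eps ^+ 2 * n%:R = (`|eps| * s) ^+ 2.
  by rewrite exprMn -ns real_normK // num_real.
have lam_ge : e / s < `|eps| -> 71 / 10 <= eps ^+ 2 * n%:R.
  rewrite ltr_pdivrMr // lam_sq => h.
  by move: h e83; clear; move: (`|eps| * s) => y; nra.
have win0 : 0 < e / s by rewrite divr_gt0 // /e expR_gt0.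
split.
- move=> epsneg.
  have en : eps < 0 by apply: lt_trans epsneg _; rewrite oppr_lt0.
  have a0 : 0 < `|eps| by rewrite normr_gt0 lt_eqF.
  have lam : 71 / 10 <= eps ^+ 2 * n%:R by apply: lam_ge; rewrite ltr0_norm // ltrNr.
  have lam0 : 0 < eps ^+ 2 * n%:R by apply: lt_le_trans lam; clear; lra.
  set L := ln (eps ^+ 2 * n%:R).
  have L0 : 0 <= L by apply: ln_ge0; apply: le_trans lam; clear; lra.
  have eL : eps ^+ 2 * n%:R = expR L by rewrite lnK.
  have X0 : 0 <= 1 / 10000 * `|eps|^-1 * L / A.
    have h : 0 <= `|eps|^-1 by rewrite invr_ge0.
    exact: divr_ge0 (mulr_ge0 (mulr_ge0 (ltW c0) h) L0) (ltW A0).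
  have [m [mX ->]] := dispersion_time_le_prob iidG (Ordinal n_gt0) M0 X0.
  rewrite lee_fin.
  case: m mX => [|m] mX; first by rewrite extinct_prob0 ?expR_ge0.
  have aAm : A * (`|eps| * m.+1%:R) <= L / 10000.
    have := ler_wpM2l (mulr_ge0 (ltW A0) (ltW a0)) mX.
    have -> : A * `|eps| * (1 / 10000 * `|eps|^-1 * L / A) = L / 10000.
      by field; rewrite !gt_eqF.
    by rewrite mulrA.
  have am0 : 0 <= `|eps| * m.+1%:R by rewrite mulr_ge0.
  have am : `|eps| * m.+1%:R <= A * (`|eps| * m.+1%:R) by rewrite ler_peMl.
  (* For large A the time bound is at most 1 / (1200 |eps|), where the drift does
     not matter; for small A a bound by a small power of eps^2 n is enough. *)
  have [hA|hA] := leP (1200 * (L / 10000)) A.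
    have Ls : L <= 2 * (`|eps| * s).
      have y0 : 0 < `|eps| * s by rewrite mulr_gt0.
      rewrite /L lam_sq lnXn // mulr2n.
      by have := ln_sublinear y0; clear; lra.
    apply: (near_critical n40 eM' epsle ns s12 (ltn0Sn m) A1 _ _ val uM) => [|_].
      rewrite -(ler_pM2l a0) mulrCA; apply: (le_trans aAm).
      by move: Ls; clear; lra.
    have : 1200 * (A * (`|eps| * m.+1%:R)) <= A.
      apply: le_trans hA.
      by move: aAm; clear; lra.
    have -> : 1200 * (A * (`|eps| * m.+1%:R)) = A * (1200 * (`|eps| * m.+1%:R)).
      by rewrite mulrCA.
    rewrite (ger_pMr _ A0); clear; lra.
  have am' : `|eps| * m.+1%:R <= L / 10000 := le_trans am aAm.
  apply: le_trans (subcritical_long n40 eM' epsle en eL L0 am' val uM) _.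
  rewrite ler_expR; move: hA; clear; lra.
- move=> epsw.
  have X0 : 0 <= 1 / 10000 * s / A.
    exact: divr_ge0 (mulr_ge0 (ltW c0) (ltW s0)) (ltW A0).
  have [m [mX ->]] := dispersion_time_le_prob iidG (Ordinal n_gt0) M0 X0.
  rewrite lee_fin.
  case: m mX => [|m] mX; first by rewrite extinct_prob0 ?expR_ge0.
  have Am : A * m.+1%:R <= s / 10000.
    by move: mX; rewrite ler_pdivlMr // mulrC; clear; lra.
  apply: (near_critical n40 eM' epsle ns s12 (ltn0Sn m) A1 _ _ val uM) => [|_].
    by apply: (le_trans Am); move: s0; clear; lra.
  have mAm : m.+1%:R <= A * m.+1%:R by rewrite ler_peMl.
  have h1 : `|eps| * m.+1%:R <= e / s * (s / 10000).
    by apply: ler_pM => //; exact: le_trans mAm Am.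
  apply: (le_trans h1).
  have -> : e / s * (s / 10000) = e / 10000 by field; rewrite gt_eqF.
  by move: e4; clear; lra.
- move=> epspos.
  have ep : 0 < eps := lt_trans win0 epspos.
  have lam : 71 / 10 <= eps ^+ 2 * n%:R by apply: lam_ge; rewrite gtr0_norm.
  have epsle2 : eps <= (10 ^+ 15)^-1 by move: epsle; rewrite -/eps gtr0_norm.
  have k0E : k0 = expR (eps ^+ 2 * n%:R / 10000).
    by rewrite /k0; congr expR; clear; lra.
  have k00 : 0 < k0 by exact: expR_gt0.
  have X0 : 0 < eps^-1 * k0 / A by rewrite divr_gt0 ?mulr_gt0 ?invr_gt0.
  have [m [mX ->]] := dispersion_time_lt_prob iidG (Ordinal n_gt0) M0 X0.
  rewrite lee_fin.
  have Aem : A * (eps * m%:R) <= k0.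
    have := ler_wpM2l (mulr_ge0 (ltW A0) (ltW ep)) (ltW mX).
    have -> : A * eps * (eps^-1 * k0 / A) = k0 by field; rewrite !gt_eqF.
    by rewrite mulrA.
  case: ifPn => kA.
    case: m mX Aem => [|m] mX Aem; first by rewrite extinct_prob0 ?expR_ge0.
    have B1 : 1 <= A / k0 by rewrite ler_pdivlMr // mul1r ltW.
    have Bm : A / k0 * (eps * m.+1%:R) <= 1.
      by rewrite mulrAC ler_pdivrMr // mul1r.
    have := supercritical_short n40 eM' ep epsle2 ns s12 lam (ltn0Sn m) B1 Bm val uM.
    by congr (_ <= expR (- _)); rewrite !mulrA mulrAC -!mulrA; congr (_ * _); ring.
  rewrite -leNgt in kA; rewrite k0E in kA Aem.
  exact: (supercritical_long n40 eM' ep epsle2 ns s12 lam A1 kA Aem val uM).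
Qed.
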